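(* Let $\lambda<1$ and let $\mathcal{S}(\lambda)=\bigcup_{\alpha\in(-\pi/2,\pi/2)}\mathcal{S}^*_\alpha(\lambda)$. Then the set of $\gamma\in\mathbb{C}$ such that $J_\gamma[f]\in\mathcal{S}$ for every $f\in\mathcal{S}(\lambda)$ equals $\{\gamma\in\mathbb{C}: |\gamma|\le \frac{1}{2(1-\lambda)}\}$.
   Context: $\mathbb{D}$ is the open unit disk; $\mathcal{A}$ the class of analytic $f$ on $\mathbb{D}$ with $f(0)=0$, $f'(0)=1$; $\mathcal{S}\subset\mathcal{A}$ the univalent functions. For $\alpha\in(-\pi/2,\pi/2)$, $\lambda<1$, $\mathcal{S}^*_\alpha(\lambda)=\{f\in\mathcal{A}: f(z)\neq0 \text{ for } z\ne 0,\ \mathrm{Re}\,(e^{i\alpha}zf'(z)/f(z))>\lambda\cos\alpha \text{ on }\mathbb{D}\}$. For $\gamma\in\mathbb{C}$, $J_\gamma[f](z)=\int_0^z (f(w)/w)^\gamma\,dw$, with the branch of $(f(w)/w)^\gamma$ equal to $1$ at $w=0$. *)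

(* Defs.v *)
From Stdlib Require Import Reals.
From Coquelicot Require Import Coquelicot.
Open Scope R_scope.

Definition cexp (z : C) : C :=
  (exp (Re z) * cos (Im z), exp (Re z) * sin (Im z)).

Definition in_disk (z : C) : Prop := Cmod z < 1.

Definition analytic_on_disk (f : C -> C) : Prop :=
  forall z : C, in_disk z -> ex_derive (K := C_AbsRing) (V := C_NormedModule) f z.

Definition classA (f : C -> C) : Prop :=
  analytic_on_disk f /\ f (RtoC 0) = RtoC 0 /\
  is_derive (K := C_AbsRing) (V := C_NormedModule) f (RtoC 0) (RtoC 1).

Definition classS (f : C -> C) : Prop :=
  classA f /\ forall z w : C, in_disk z -> in_disk w -> f z = f w -> z = w.

(* S*_alpha(lambda).  At z = 0 the quotient z f'(z)/f(z) equals 1 (by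
   continuity), and Re (e^{i alpha}) = cos alpha > lambda cos alpha always
   holds, so the condition is only imposed for z <> 0. *)
Definition spirallike (alpha lambda : R) (f : C -> C) : Prop :=
  classA f /\
  (forall z : C, in_disk z -> z <> RtoC 0 -> f z <> RtoC 0) /\
  (forall z l : C, in_disk z -> z <> RtoC 0 ->
     is_derive (K := C_AbsRing) (V := C_NormedModule) f z l ->
     Re (cexp (0, alpha) * (z * l / f z))%C > lambda * cos alpha).

Definition classS_lambda (lambda : R) (f : C -> C) : Prop :=
  exists alpha : R, - (PI / 2) < alpha < PI / 2 /\ spirallike alpha lambda f.

(* h is the branch of log (f(w)/w) on D with h(0) = 0 (which is then the
   branch of (f(w)/w)^gamma := exp (gamma h(w)) equal to 1 at w = 0). *)
Definition log_branch (f h : C -> C) : Prop :=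
  analytic_on_disk h /\ h (RtoC 0) = RtoC 0 /\
  forall w : C, in_disk w -> w <> RtoC 0 -> cexp (h w) = (f w / w)%C.

(* J_gamma[f](z) = \int_0^z (f(w)/w)^gamma dw, integrated along the segment
   [0, z]:  \int_0^1 exp (gamma h(t z)) z dt. *)
Definition Jgamma (gamma : C) (h : C -> C) (z : C) : C :=
  @RInt C_R_CompleteNormedModule
    (fun t : R => (cexp (gamma * h (RtoC t * z)) * z)%C) 0 1.

Definition J_in_S (gamma : C) (f : C -> C) : Prop :=
  forall h : C -> C, log_branch f h -> classS (Jgamma gamma h).

(* Main.v *)
Require Import Defs.
From Stdlib Require Import Reals Lra Lia ClassicalEpsilon.
From Coquelicot Require Import Coquelicot.
Open Scope R_scope.

(** Sufficiency.  Write [k = (1 - lambda) cos alpha e^(- i alpha)].  The spirallikeness condition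
    says that [v = z h'(z) / k] has real part [> -1], so [|v| <= |z| |v + 2|] by the Schwarz
    lemma, that is, [|(1 - |z|^2) v - 2 |z|^2| <= 2 |z|].  As [z J'' / J' = gamma k v] and
    [2 |gamma k| <= 1], the function [J] satisfies Ahlfors' univalence criterion
    [|(1 - |z|^2) z J'' / J' + c |z|^2| <= 1] with [c = - 2 gamma k].

    Ahlfors' criterion.  On [|z| <= r < 1] put [G_s = s (1 + r^2 c) J + (1 - s) z J'].  If
    [G_s] takes a value twice on [|z|^2 <= s r^2], then Newton's method and the criterion produce
    a collision of the same kind for a slightly smaller [s]; the absence of collisions is an open
    condition on [s] by compactness, and it holds for [s = 0], where the domain is a point.

    Necessity.  For [f(z) = z (1 - z)^(- 2 k)], [J] is an affine function of
    [(1 - z)^(1 - 2 gamma k)], which is not injective as soon as [|2 gamma k| > 1] and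
    [|2 gamma k - 2| > 1]; some [alpha] achieves both. *)

Open Scope C_scope.

Lemma Cmod_minus_sym (a b : C) : Cmod (a - b) = Cmod (b - a).
Proof. rewrite <- Cmod_opp. f_equal. ring. Qed.

Lemma Cmod_minus_triangle (a b c : C) : Cmod (a - c) <= Cmod (a - b) + Cmod (b - c).
Proof. replace (a - c) with ((a - b) + (b - c)) by ring. apply Cmod_triangle. Qed.

Lemma Cmod_triangle_inv (a b : C) : Cmod a - Cmod b <= Cmod (a - b).
Proof.
  pose proof (Cmod_triangle (a - b) b) as H.
  replace (a - b + b) with a in H by ring. lra.
Qed.

Lemma Cmod_minus_le (a b : C) : Cmod (a - b) <= Cmod a + Cmod b.
Proof. rewrite <- (Cmod_opp b). apply Cmod_triangle. Qed.

Lemma Cmod_minus_self (a : C) : Cmod (a - a) = 0%R.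
Proof. rewrite <- Cmod_0. f_equal. ring. Qed.

Lemma Cminus_eq_0 (a b : C) : a - b = 0 -> a = b.
Proof. intros H. replace a with (a - b + b) by ring. rewrite H. ring. Qed.

Lemma Cmod_minus_gt_0 (a b : C) : a <> b -> 0 < Cmod (a - b).
Proof. intros H. apply Cmod_gt_0. intros E. apply H, Cminus_eq_0, E. Qed.

Lemma Cmod_minus_le_0 (a b : C) : Cmod (a - b) <= 0 -> a = b.
Proof.
  intros H. apply Cminus_eq_0, Cmod_eq_0, Rle_antisym; [exact H|apply Cmod_ge_0].
Qed.

Lemma Cmod_mult_le (a b : C) (A B : R) : Cmod a <= A -> Cmod b <= B -> Cmod (a * b) <= A * B.
Proof. intros. rewrite Cmod_mult. apply Rmult_le_compat; auto; apply Cmod_ge_0. Qed.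

Lemma RtoC_neq_0 (x : R) : x <> 0%R -> RtoC x <> 0.
Proof. intros H E. apply H. now injection E. Qed.

(** * Complex derivatives and continuity *)

Lemma is_derive_Cmod (f : C -> C) (z l : C) :
  is_derive f z l <->
  forall e : R, 0 < e -> exists d : R, 0 < d /\ forall w : C,
    Cmod (w - z) < d -> Cmod (f w - f z - l * (w - z)) <= e * Cmod (w - z).
Proof.
  split.
  - intros [_ H] e He.
    destruct (H z (fun P HP => HP) (mkposreal e He)) as [d Hd].
    exists d. split; [apply cond_pos|]. intros w Hw.
    rewrite (Cmult_comm l). exact (Hd w Hw).
  - intros H. split; [apply is_linear_scal_l|].
    intros x Hx.
    assert (x = z) as ->.
    { symmetry. exact (is_filter_lim_locally_unique (K := C_AbsRing)
        (V := AbsRing_NormedModule C_AbsRing) z x Hx). }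
    intros e. destruct (H e (cond_pos e)) as (d & Hd & Hf).
    exists (mkposreal d Hd). intros w Hw. specialize (Hf w Hw).
    rewrite (Cmult_comm l) in Hf. exact Hf.
Qed.

(* Coquelicot puts two normed-module structures on [C]; its product and chain
   rules are stated for the one derived from the absolute ring. *)
Lemma is_derive_AbsRing_C (f : C -> C) (z l : C) :
  is_derive (V := AbsRing_NormedModule C_AbsRing) f z l <-> is_derive f z l.
Proof. split; intros [_ H]; (split; [apply is_linear_scal_l|exact H]). Qed.

Section DerivativeRules.
Implicit Types (f g : C -> C) (z l m c : C).

Lemma is_derive_Ceq f z l m : is_derive f z l -> l = m -> is_derive f z m.
Proof. now intros H <-. Qed.

Lemma is_derive_Cconst c z : is_derive (fun _ : C => c) z (RtoC 0).
Proof. exact (is_derive_const c z). Qed.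

Lemma is_derive_Cid z : is_derive (fun w : C => w) z (RtoC 1).
Proof. apply is_derive_AbsRing_C, (is_derive_id (K := C_AbsRing)). Qed.

Lemma is_derive_Cplus f g z l m :
  is_derive f z l -> is_derive g z m -> is_derive (fun w => f w + g w) z (l + m).
Proof. exact (is_derive_plus f g z l m). Qed.

Lemma is_derive_Cminus f g z l m :
  is_derive f z l -> is_derive g z m -> is_derive (fun w => f w - g w) z (l - m).
Proof. exact (is_derive_minus f g z l m). Qed.

Lemma is_derive_Copp f z l : is_derive f z l -> is_derive (fun w => - f w) z (- l).
Proof. exact (is_derive_opp f z l). Qed.

Lemma is_derive_Cmult f g z l m :
  is_derive f z l -> is_derive g z m -> is_derive (fun w => f w * g w) z (l * g z + f z * m).
Proof.
  intros Hf Hg. apply is_derive_AbsRing_C.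
  apply (is_derive_mult f g z l m); [..|exact Cmult_comm]; now apply is_derive_AbsRing_C.
Qed.

Lemma is_derive_Cscal c f z l : is_derive f z l -> is_derive (fun w => c * f w) z (c * l).
Proof.
  intros H. eapply is_derive_Ceq.
  - apply is_derive_Cmult; [apply is_derive_Cconst|exact H].
  - cbv beta. ring.
Qed.

Lemma is_derive_Ccomp f g z l m :
  is_derive f (g z) m -> is_derive g z l -> is_derive (fun w => f (g w)) z (m * l).
Proof.
  intros Hf Hg. rewrite Cmult_comm. apply (is_derive_comp f g z m l Hf).
  now apply is_derive_AbsRing_C.
Qed.

End DerivativeRules.

Lemma is_derive_Cinv (z : C) : z <> 0 -> is_derive Cinv z (- / (z * z)).
Proof.
  intros Hz. apply is_derive_Cmod. intros e He.
  assert (Pz := proj1 (Cmod_gt_0 z) Hz). set (m := Cmod z) in *.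
  assert (Pm : 0 < m * m * m) by (repeat apply Rmult_lt_0_compat; lra).
  exists (Rmin (m / 2) (e * (m * m * m) / 2))%R. split.
  { apply Rmin_glb_lt; [lra|]. apply Rdiv_lt_0_compat; [nra|lra]. }
  intros w Hw. apply Rmin_Rgt_l in Hw as [Hw1 Hw2].
  assert (Pw : m / 2 < Cmod w).
  { pose proof (Cmod_triangle_inv z w) as H. rewrite Cmod_minus_sym in H. fold m in H. lra. }
  assert (Hw0 : w <> 0) by (apply Cmod_gt_0; lra).
  replace (/ w - / z - - / (z * z) * (w - z)) with ((w - z) * (w - z) / (w * (z * z)))
    by (field; auto).
  rewrite Cmod_div, !Cmod_mult by (repeat apply Cmult_neq_0; auto). fold m.
  apply Rle_div_l; [nra|].
  assert (0 < m * m) by nra.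
  assert (m / 2 * (m * m) <= Cmod w * (m * m)) by (apply Rmult_le_compat_r; lra).
  assert (e * (m / 2 * (m * m)) <= e * (Cmod w * (m * m))) by (apply Rmult_le_compat_l; lra).
  pose proof (Cmod_ge_0 (w - z)).
  rewrite (Rmult_comm e), Rmult_assoc. apply Rmult_le_compat_l; lra.
Qed.

Lemma is_derive_Cinv_comp (f : C -> C) (z l : C) : is_derive f z l -> f z <> 0 ->
  is_derive (fun w => / f w) z (- l / (f z * f z)).
Proof.
  intros Hf Hz. eapply is_derive_Ceq.
  - apply is_derive_Ccomp; [apply is_derive_Cinv, Hz|exact Hf].
  - field. exact Hz.
Qed.

Lemma is_derive_Cpow (f : C -> C) (n : nat) (z l : C) : is_derive f z l ->
  is_derive (fun w => f w ^ n) z (RtoC (INR n) * l * f z ^ pred n).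
Proof.
  intros Hf. induction n as [|n IH].
  - eapply is_derive_Ceq; [exact (is_derive_Cconst 1 z)|simpl; ring].
  - eapply is_derive_Ceq; [exact (is_derive_Cmult f (fun w => f w ^ n) z _ _ Hf IH)|].
    rewrite S_INR, RtoC_plus. cbn [pred].
    destruct n as [|n]; [simpl; ring|].
    rewrite !Cpow_S. cbn [pred]. ring.
Qed.

Lemma is_derive_ext_disk (f g : C -> C) (rho : R) (z l : C) :
  (forall w, Cmod w < rho -> f w = g w) -> Cmod z < rho -> is_derive f z l -> is_derive g z l.
Proof.
  intros Hfg Hz. apply is_derive_ext_loc.
  assert (Hd : 0 < rho - Cmod z) by lra. exists (mkposreal _ Hd). intros w Hw. apply Hfg.
  change (Cmod (w - z) < rho - Cmod z) in Hw. pose proof (Cmod_triangle_inv w z). lra.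
Qed.

Lemma is_derive_unique_ext_disk (f g : C -> C) (rho : R) (z l m : C) :
  (forall w, Cmod w < rho -> f w = g w) -> Cmod z < rho ->
  is_derive f z l -> is_derive g z m -> l = m.
Proof.
  intros Hfg Hz Hf Hg. rewrite <- (is_C_derive_unique g z m Hg). symmetry.
  apply is_C_derive_unique. now apply (is_derive_ext_disk f g rho).
Qed.

Lemma continuous_Cmod (f : C -> C) (z : C) :
  continuous f z <->
  forall e : R, 0 < e -> exists d : R, 0 < d /\ forall w : C,
    Cmod (w - z) < d -> Cmod (f w - f z) < e.
Proof.
  split.
  - intros H e He.
    assert (P : 0 < e / sqrt 2) by (apply Rdiv_lt_0_compat; [lra|apply sqrt_lt_R0; lra]).
    destruct (proj1 (locally_C _ _) (H _ (locally_ball (f z) (mkposreal _ P)))) as [d Hd].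
    exists d. split; [apply cond_pos|]. intros w Hw.
    replace e with (sqrt 2 * (e / sqrt 2))%R by (field; apply Rgt_not_eq, sqrt_lt_R0; lra).
    exact (C_NormedModule_mixin_compat2 _ _ (mkposreal _ P) (Hd w Hw)).
  - intros H P [e He]. destruct (H e (cond_pos e)) as (d & Hd & Hf).
    apply locally_C. exists (mkposreal d Hd). intros w Hw.
    apply He, C_NormedModule_mixin_compat1, Hf, Hw.
Qed.

Lemma continuous_Cmod_pair (F : C -> C -> C) (a z : C) :
  continuous (fun p : C * C => F (fst p) (snd p)) (a, z) ->
  forall e, 0 < e -> exists d, 0 < d /\ forall b w,
    Cmod (b - a) < d -> Cmod (w - z) < d -> Cmod (F b w - F a z) < e.
Proof.
  intros H e He.
  assert (P : 0 < e / sqrt 2) by (apply Rdiv_lt_0_compat; [lra|apply sqrt_lt_R0; lra]).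
  destruct (H _ (locally_ball (F a z) (mkposreal _ P))) as [d Hd].
  exists d. split; [apply cond_pos|]. intros b w Hb Hw.
  replace e with (sqrt 2 * (e / sqrt 2))%R by (field; apply Rgt_not_eq, sqrt_lt_R0; lra).
  apply (C_NormedModule_mixin_compat2 (F a z) (F b w) (mkposreal _ P)), (Hd (b, w)).
  split; now apply C_NormedModule_mixin_compat1.
Qed.

Lemma is_derive_continuous (f : C -> C) (z l : C) : is_derive f z l -> continuous f z.
Proof.
  intros H P HP. apply locally_C.
  apply (ex_derive_continuous (K := C_AbsRing) f z); [now exists l|exact HP].
Qed.

Section ContinuityRules.
Context {U : UniformSpace}.
Implicit Types (f g : U -> C) (x : U).

Lemma continuous_fst_snd f x :
  continuous (fun y => fst (f y)) x -> continuous (fun y => snd (f y)) x -> continuous f x.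
Proof.
  intros H1 H2. apply (continuous_ext (fun y => (fst (f y), snd (f y)) : C)).
  { intros y. symmetry. apply surjective_pairing. }
  apply (continuous_comp_2 (W := R_UniformSpace) _ _ (fun a b => (a, b) : C) x H1 H2).
  apply (continuous_ext (fun p => p)); [intros [a b]; reflexivity|apply continuous_id].
Qed.

Lemma continuous_Re f x : continuous f x -> continuous (fun y => fst (f y)) x.
Proof.
  intros H. apply (continuous_comp f fst x H). destruct (f x). apply continuous_fst.
Qed.

Lemma continuous_Im f x : continuous f x -> continuous (fun y => snd (f y)) x.
Proof.
  intros H. apply (continuous_comp f snd x H). destruct (f x). apply continuous_snd.
Qed.

Lemma continuous_Cplus f g x :
  continuous f x -> continuous g x -> continuous (fun y => f y + g y) x.
Proof. exact (continuous_plus (V := C_NormedModule) f g x). Qed.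

Lemma continuous_Cminus f g x :
  continuous f x -> continuous g x -> continuous (fun y => f y - g y) x.
Proof. exact (continuous_minus (V := C_NormedModule) f g x). Qed.

Lemma continuous_Cmult f g x :
  continuous f x -> continuous g x -> continuous (fun y => f y * g y) x.
Proof.
  intros Hf Hg.
  assert (Hf1 := continuous_Re f x Hf). assert (Hf2 := continuous_Im f x Hf).
  assert (Hg1 := continuous_Re g x Hg). assert (Hg2 := continuous_Im g x Hg).
  apply continuous_fst_snd.
  - apply (continuous_minus (V := R_NormedModule)); now apply (continuous_mult (K := R_AbsRing)).
  - apply (continuous_plus (V := R_NormedModule)); now apply (continuous_mult (K := R_AbsRing)).
Qed.

Lemma continuous_Ccomp (F : C -> C) g x :
  continuous g x -> continuous F (g x) -> continuous (fun y => F (g y)) x.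
Proof. exact (continuous_comp g F x). Qed.

Lemma continuous_Cinv f x : continuous f x -> f x <> 0 -> continuous (fun y => / f y) x.
Proof.
  intros Hf H0. apply continuous_Ccomp; [exact Hf|].
  eapply is_derive_continuous, is_derive_Cinv, H0.
Qed.

Lemma continuous_Cpow f n x : continuous f x -> continuous (fun y => f y ^ n) x.
Proof.
  intros Hf. induction n as [|n IH]; [apply continuous_const|].
  now apply (continuous_Cmult f (fun y => f y ^ n)).
Qed.

End ContinuityRules.

(* Curves are treated as restrictions to the real axis of complex-differentiable
   functions, so that all differentiation takes place in the complex variable. *)
Lemma is_derive_RtoC (f : C -> C) (t : R) (l : C) : is_derive f (RtoC t) l ->
  is_derive (V := C_R_NormedModule) (fun s : R => f (RtoC s)) t l.
Proof.
  intros H. split; [apply is_linear_scal_l|].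
  intros x Hx e.
  assert (t = x) as <- by exact (is_filter_lim_locally_unique (V := R_NormedModule) t x Hx).
  destruct (proj1 (is_derive_Cmod f t l) H e (cond_pos e)) as (d & Hd & Hf).
  exists (mkposreal d Hd). intros s Hs. specialize (Hf (RtoC s)).
  rewrite <- RtoC_minus, Cmod_R in Hf. specialize (Hf Hs).
  rewrite Cmod_norm in Hf.
  match type of Hf with norm ?x <= _ => match goal with |- norm ?y <= _ =>
    replace y with x; [exact Hf|] end end.
  apply injective_projections; simpl; unfold minus, plus, opp, scal; simpl;
    unfold mult; simpl; ring.
Qed.

Lemma continuous_RtoC (t : R) : continuous RtoC t.
Proof. apply continuous_fst_snd; [apply continuous_id|apply continuous_const]. Qed.

Notation CRInt := (@RInt C_R_CompleteNormedModule).
Notation is_CRInt := (@is_RInt C_R_NormedModule).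

Lemma is_CRInt_CRInt (f : R -> C) (a b : R) : a <= b ->
  (forall t, a <= t <= b -> continuous f t) -> is_CRInt f a b (CRInt f a b).
Proof.
  intros Hab H. apply (@RInt_correct C_R_CompleteNormedModule).
  apply (@ex_RInt_continuous C_R_CompleteNormedModule). intros z Hz.
  rewrite Rmin_left, Rmax_right in Hz by lra. now apply H.
Qed.

Lemma is_CRInt_scal (c : C) (f : R -> C) (a b : R) (l : C) :
  is_CRInt f a b l -> is_CRInt (fun t => c * f t) a b (c * l).
Proof.
  intros H.
  pose proof (is_RInt_fct_extend_fst (U := R_NormedModule) (V := R_NormedModule) f a b l H) as H1.
  pose proof (is_RInt_fct_extend_snd (U := R_NormedModule) (V := R_NormedModule) f a b l H) as H2.
  apply (is_RInt_fct_extend_pair (U := R_NormedModule) (V := R_NormedModule)).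
  - apply (is_RInt_minus (V := R_NormedModule)); now apply (is_RInt_scal (V := R_NormedModule)).
  - apply (is_RInt_plus (V := R_NormedModule)); now apply (is_RInt_scal (V := R_NormedModule)).
Qed.

Lemma is_CRInt_derive (F f : C -> C) (a b : R) : a <= b ->
  (forall t : R, a <= t <= b -> is_derive F (RtoC t) (f t)) ->
  (forall t : R, a <= t <= b -> continuous f (RtoC t)) ->
  is_CRInt (fun t => f (RtoC t)) a b (F b - F a).
Proof.
  intros Hab HF Hf.
  apply (@is_RInt_derive C_R_CompleteNormedModule (fun t => F (RtoC t)));
    intros t Ht; rewrite Rmin_left, Rmax_right in Ht by lra.
  - now apply is_derive_RtoC, HF.
  - apply (continuous_Ccomp f RtoC); [apply continuous_RtoC|now apply Hf].
Qed.

Lemma Cmod_is_CRInt_le (f : R -> C) (a b : R) (l : C) (M : R) : a <= b ->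
  (forall t, a <= t <= b -> Cmod (f t) <= M) -> is_CRInt f a b l -> Cmod l <= (b - a) * M.
Proof.
  intros Hab H Hl. rewrite Cmod_norm. apply (norm_RInt_le_const f a b l M Hab); [|exact Hl].
  intros x Hx. rewrite <- Cmod_norm. now apply H.
Qed.

Lemma cexp_plus (a b : C) : cexp (a + b) = cexp a * cexp b.
Proof.
  unfold cexp, Cmult, Re, Im; destruct a, b; simpl. rewrite exp_plus, cos_plus, sin_plus.
  f_equal; ring.
Qed.

Lemma cexp_0 : cexp 0 = 1.
Proof. unfold cexp; simpl. rewrite exp_0, cos_0, sin_0. unfold RtoC; f_equal; ring. Qed.

Lemma Cmod_cexp (z : C) : Cmod (cexp z) = exp (Re z).
Proof.
  unfold cexp, Cmod; simpl fst; simpl snd.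
  replace ((exp (Re z) * cos (Im z)) ^ 2 + (exp (Re z) * sin (Im z)) ^ 2)%R
    with (exp (Re z) ^ 2 * (Rsqr (sin (Im z)) + Rsqr (cos (Im z))))%R by (unfold Rsqr; ring).
  rewrite sin2_cos2, Rmult_1_r. apply sqrt_pow2. left; apply exp_pos.
Qed.

Lemma cexp_neq_0 (z : C) : cexp z <> 0.
Proof. apply Cmod_gt_0. rewrite Cmod_cexp. apply exp_pos. Qed.

Lemma cexp_opp (z : C) : cexp (- z) = / cexp z.
Proof.
  assert (H : cexp (- z) * cexp z = 1).
  { rewrite <- cexp_plus, <- cexp_0. f_equal. ring. }
  pose proof (cexp_neq_0 z).
  replace (cexp (- z)) with (cexp (- z) * cexp z * / cexp z) by (field; auto).
  rewrite H. ring.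
Qed.

Lemma Cmod_le_Rabs (z : C) : Cmod z <= Rabs (fst z) + Rabs (snd z).
Proof.
  destruct z as [a b]. pose proof (Cmod_triangle (RtoC a) (Ci * RtoC b)) as H.
  rewrite Cmod_mult, Cmod_Ci, !Cmod_R, Rmult_1_l in H.
  replace (a + Ci * b) with (a, b) in H; [exact H|].
  apply injective_projections; simpl; ring.
Qed.

Lemma is_derive_Cauchy_Riemann (u v : R -> R -> R) (x y a b : R) :
  differentiable_pt_lim u x y a (- b) -> differentiable_pt_lim v x y b a ->
  is_derive (fun z : C => (u (fst z) (snd z), v (fst z) (snd z)) : C) (x, y) (a, b).
Proof.
  intros Hu Hv. apply is_derive_Cmod. intros e He.
  assert (He2 : 0 < e / 2) by lra.
  destruct (Hu (mkposreal _ He2)) as [d1 H1]. destruct (Hv (mkposreal _ He2)) as [d2 H2].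
  exists (Rmin d1 d2). split; [apply Rmin_glb_lt; apply cond_pos|].
  intros [s t] Hw. apply Rmin_Rgt_l in Hw as [Hw1 Hw2].
  pose proof (Rmax_Cmod ((s, t) - (x, y))) as Hm.
  pose proof (Rmax_l (Rabs (s - x)) (Rabs (t - y))).
  pose proof (Rmax_r (Rabs (s - x)) (Rabs (t - y))).
  change (Rmax (Rabs (s - x)) (Rabs (t - y)) <= Cmod ((s, t) - (x, y))) in Hm.
  specialize (H1 s t ltac:(lra) ltac:(lra)). specialize (H2 s t ltac:(lra) ltac:(lra)).
  simpl pos in H1, H2. eapply Rle_trans; [apply Cmod_le_Rabs|]. simpl fst; simpl snd.
  match goal with |- Rabs ?p + Rabs ?q <= _ =>
    replace p with (u s t - u x y - (a * (s - x) + - b * (t - y)))%R by ring;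
    replace q with (v s t - v x y - (b * (s - x) + a * (t - y)))%R by ring end.
  nra.
Qed.

Lemma differentiable_pt_lim_exp_mult (q : R -> R) (x y b : R) : is_derive q y b ->
  differentiable_pt_lim (fun s t => exp s * q t)%R x y (exp x * q y) (exp x * b).
Proof.
  intros Hq. apply filterdiff_differentiable_pt_lim.
  apply (is_derive_filterdiff (fun s t => exp s * q t)%R x y
    (fun s t => exp s * q t)%R (exp x * b)%R).
  - apply filter_forall. intros [s t]. simpl. auto_derive; [easy|ring].
  - now apply is_derive_scal.
  - apply (continuous_mult (K := R_AbsRing)).
    + apply (continuous_comp fst exp); [apply continuous_fst|apply continuous_exp].
    + apply (continuous_comp snd q); [apply continuous_snd|].
      apply (ex_derive_continuous (V := R_NormedModule)). now exists b.
Qed.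

Lemma is_derive_cexp (z : C) : is_derive cexp z (cexp z).
Proof.
  destruct z as [x y].
  apply (is_derive_Cauchy_Riemann (fun s t => exp s * cos t)%R (fun s t => exp s * sin t)%R).
  - simpl. rewrite Ropp_mult_distr_r. apply differentiable_pt_lim_exp_mult, is_derive_cos.
  - simpl. apply differentiable_pt_lim_exp_mult, is_derive_sin.
Qed.

Lemma is_derive_cexp_comp (f : C -> C) (z l : C) : is_derive f z l ->
  is_derive (fun w => cexp (f w)) z (cexp (f z) * l).
Proof. apply is_derive_Ccomp, is_derive_cexp. Qed.

(** * Integration along segments *)

Definition seg (a b t : C) : C := a + t * (b - a).

Lemma seg_0 (a b : C) : seg a b 0 = a.
Proof. unfold seg. ring. Qed.

Lemma seg_1 (a b : C) : seg a b 1 = b.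
Proof. unfold seg. ring. Qed.

Lemma is_derive_seg (a b t : C) : is_derive (seg a b) t (b - a).
Proof.
  eapply is_derive_Ceq.
  - apply is_derive_Cplus; [apply is_derive_Cconst|].
    apply is_derive_Cmult; [apply is_derive_Cid|apply is_derive_Cconst].
  - cbv beta. ring.
Qed.

Lemma continuous_seg (a b t : C) : continuous (seg a b) t.
Proof. eapply is_derive_continuous, is_derive_seg. Qed.

Lemma Cmod_seg_le (a b : C) (t M : R) : 0 <= t <= 1 ->
  Cmod a <= M -> Cmod b <= M -> Cmod (seg a b t) <= M.
Proof.
  intros Ht Ha Hb. unfold seg.
  replace (a + t * (b - a)) with (RtoC (1 - t) * a + RtoC t * b) by (rewrite RtoC_minus; ring).
  eapply Rle_trans; [apply Cmod_triangle|].
  rewrite !Cmod_mult, !Cmod_R, !Rabs_right by lra. nra.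
Qed.

Lemma Cmod_seg_lt (a b : C) (t M : R) : 0 <= t <= 1 ->
  Cmod a < M -> Cmod b < M -> Cmod (seg a b t) < M.
Proof.
  intros Ht Ha Hb. apply Rle_lt_trans with (Rmax (Cmod a) (Cmod b)).
  - apply Cmod_seg_le; [exact Ht|apply Rmax_l|apply Rmax_r].
  - now apply Rmax_lub_lt.
Qed.

Lemma seg_minus (a b z t : C) : seg a b t - z = seg (a - z) (b - z) t.
Proof. unfold seg. ring. Qed.

Lemma seg_seg (a b s t u : C) : seg (seg a b s) (seg a b t) u = seg a b ((t - s) * u + s).
Proof. unfold seg. ring. Qed.

Definition continuous_on_seg (f : C -> C) (a b : C) : Prop :=
  forall t : R, 0 <= t <= 1 -> continuous f (seg a b t).

Definition segint (f : C -> C) (a b : C) : C :=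
  CRInt (fun t => f (seg a b t) * (b - a)) 0 1.

Lemma continuous_comp_seg (f : C -> C) (a b : C) (t : R) :
  continuous f (seg a b t) -> continuous (fun s : R => f (seg a b s)) t.
Proof.
  intros H. apply (continuous_Ccomp f (fun s : R => seg a b s)); [|exact H].
  apply (continuous_Ccomp (seg a b) RtoC); [apply continuous_RtoC|apply continuous_seg].
Qed.

Lemma is_CRInt_segint (f : C -> C) (a b : C) : continuous_on_seg f a b ->
  is_CRInt (fun t => f (seg a b t) * (b - a)) 0 1 (segint f a b).
Proof.
  intros H. apply is_CRInt_CRInt; [lra|]. intros t Ht.
  apply continuous_Cmult; [|apply continuous_const]. now apply continuous_comp_seg, H.
Qed.

Lemma Cmod_segint_le (f : C -> C) (a b : C) (M : R) : continuous_on_seg f a b ->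
  (forall t : R, 0 <= t <= 1 -> Cmod (f (seg a b t)) <= M) ->
  Cmod (segint f a b) <= M * Cmod (b - a).
Proof.
  intros Hf HM. replace (M * Cmod (b - a))%R with ((1 - 0) * (M * Cmod (b - a)))%R by ring.
  refine (Cmod_is_CRInt_le _ 0 1 _ _ _ _ (is_CRInt_segint f a b Hf)); [lra|].
  intros t Ht. apply Cmod_mult_le; [now apply HM|apply Rle_refl].
Qed.

Lemma segint_minus (f g : C -> C) (a b : C) :
  continuous_on_seg f a b -> continuous_on_seg g a b ->
  segint (fun z => f z - g z) a b = segint f a b - segint g a b.
Proof.
  intros Hf Hg. apply (@is_RInt_unique C_R_CompleteNormedModule).
  eapply (is_RInt_ext (V := C_R_NormedModule)).
  2: exact (@is_RInt_minus C_R_NormedModule _ _ _ _ _ _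
    (is_CRInt_segint f a b Hf) (is_CRInt_segint g a b Hg)).
  intros t _. change (f (seg a b t) * (b - a) - g (seg a b t) * (b - a) =
    (f (seg a b t) - g (seg a b t)) * (b - a)). ring.
Qed.

Lemma segint_derive (F f : C -> C) (a b : C) :
  (forall t : R, 0 <= t <= 1 -> is_derive F (seg a b t) (f (seg a b t))) ->
  continuous_on_seg f a b -> segint f a b = F b - F a.
Proof.
  intros HF Hf. apply (@is_RInt_unique C_R_CompleteNormedModule).
  replace (F b - F a) with (F (seg a b 1) - F (seg a b 0)) by now rewrite seg_1, seg_0.
  apply (is_CRInt_derive (fun t => F (seg a b t)) (fun t => f (seg a b t) * (b - a))); [lra|..];
    intros t Ht.
  - apply is_derive_Ccomp; [now apply HF|apply is_derive_seg].
  - apply continuous_Cmult; [|apply continuous_const].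
    apply continuous_Ccomp; [apply continuous_seg|now apply Hf].
Qed.

Lemma segint_const (c a b : C) : segint (fun _ => c) a b = c * (b - a).
Proof.
  rewrite (segint_derive (fun z => c * z)).
  - ring.
  - intros t _. eapply is_derive_Ceq; [apply is_derive_Cscal, is_derive_Cid|ring].
  - intros t _. apply continuous_const.
Qed.

Lemma segint_point (f : C -> C) (a : C) : segint f a a = 0.
Proof.
  rewrite <- (Cmult_0_l (a - a)), <- (segint_const 0 a a). unfold segint.
  apply (RInt_ext (V := C_R_CompleteNormedModule)). intros t _.
  change (f (seg a a t) * (a - a) = 0 * (a - a)). ring.
Qed.

Lemma Cmod_segint_minus_le (f : C -> C) (a b l : C) (e : R) : continuous_on_seg f a b ->
  (forall t : R, 0 <= t <= 1 -> Cmod (f (seg a b t) - l) <= e) ->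
  Cmod (segint f a b - l * (b - a)) <= e * Cmod (b - a).
Proof.
  intros Hf He.
  assert (Hl : continuous_on_seg (fun _ => l) a b) by (intros t _; apply continuous_const).
  rewrite <- segint_const, <- segint_minus by assumption.
  apply Cmod_segint_le; [|exact He].
  intros t Ht. apply continuous_Cminus; [now apply Hf|now apply Hl].
Qed.

Lemma Cmod_increment_le (f f1 : C -> C) (a b l : C) (e : R) :
  (forall t : R, 0 <= t <= 1 -> is_derive f (seg a b t) (f1 (seg a b t))) ->
  continuous_on_seg f1 a b ->
  (forall t : R, 0 <= t <= 1 -> Cmod (f1 (seg a b t) - l) <= e) ->
  Cmod (f b - f a - l * (b - a)) <= e * Cmod (b - a).
Proof.
  intros Hf Hf1. rewrite <- (segint_derive f f1) by assumption.
  now apply Cmod_segint_minus_le.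
Qed.

Lemma is_derive_0_seg (f : C -> C) (a b : C) :
  (forall t : R, 0 <= t <= 1 -> is_derive f (seg a b t) (RtoC 0)) -> f b = f a.
Proof.
  intros H. apply Cmod_minus_le_0.
  pose proof (Cmod_increment_le f (fun _ => 0) a b 0 0 H) as Hi.
  replace (f b - f a - 0 * (b - a)) with (f b - f a) in Hi by ring.
  rewrite Rmult_0_l in Hi. apply Hi.
  - intros t _. apply continuous_const.
  - intros t _. rewrite Cmod_minus_self. lra.
Qed.

Lemma segint_subseg (f : C -> C) (a b : C) (s t : R) : 0 <= s <= 1 -> 0 <= t <= 1 ->
  continuous_on_seg f a b ->
  is_CRInt (fun u => f (seg a b u) * (b - a)) s t (segint f (seg a b s) (seg a b t)).
Proof.
  intros Hs Ht Hf.
  assert (Hc : forall u : R, Rmin s t <= u <= Rmax s t ->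
    continuous (fun v : R => f (seg a b v) * (b - a)) u).
  { intros u Hu. apply continuous_Cmult; [|apply continuous_const].
    apply continuous_comp_seg, Hf. revert Hu. unfold Rmin, Rmax. destruct (Rle_dec s t); lra. }
  assert (H := @RInt_correct C_R_CompleteNormedModule _ _ _
    (@ex_RInt_continuous C_R_CompleteNormedModule _ s t Hc)).
  set (I := CRInt _ s t) in H.
  assert (segint f (seg a b s) (seg a b t) = I) as ->; [|exact H].
  apply (@is_RInt_unique C_R_CompleteNormedModule).
  pose proof (is_RInt_comp_lin (V := C_R_NormedModule)
    (fun u => f (seg a b u) * (b - a)) (t - s) s 0 1 I) as Hlin.
  rewrite Rmult_0_r, Rplus_0_l, Rmult_1_r in Hlin.
  replace (t - s + s)%R with t in Hlin by ring.
  refine (is_RInt_ext _ _ _ _ _ _ (Hlin H)).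
  intros u _. rewrite seg_seg, <- RtoC_minus, <- RtoC_mult, <- RtoC_plus.
  apply (@eq_trans C _ _ _ (scal_R_Cmult _ _)). rewrite RtoC_minus. unfold seg. ring.
Qed.

Lemma segint_swap (f : C -> C) (a b : C) : continuous_on_seg f a b ->
  segint f b a = - segint f a b.
Proof.
  intros Hf. assert (H01 := segint_subseg f a b 0 1). assert (H10 := segint_subseg f a b 1 0).
  rewrite seg_0, seg_1 in H01, H10.
  apply (is_RInt_unique (V := C_R_CompleteNormedModule)) in H01; [|lra|lra|exact Hf].
  assert (H := is_RInt_swap _ _ _ _ (H10 ltac:(lra) ltac:(lra) Hf)).
  apply (is_RInt_unique (V := C_R_CompleteNormedModule)) in H. rewrite H01 in H.
  rewrite H. change (segint f b a = - - segint f b a). ring.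
Qed.

Lemma segint_Chasles (f : C -> C) (a b : C) (t : R) : 0 <= t <= 1 ->
  continuous_on_seg f a b ->
  segint f a b = segint f a (seg a b t) + segint f (seg a b t) b.
Proof.
  intros Ht Hf.
  assert (H0t := segint_subseg f a b 0 t ltac:(lra) Ht Hf).
  assert (Ht1 := segint_subseg f a b t 1 Ht ltac:(lra) Hf).
  rewrite seg_0 in H0t. rewrite seg_1 in Ht1.
  apply (is_RInt_unique (V := C_R_CompleteNormedModule)).
  exact (is_RInt_Chasles (V := C_R_NormedModule) _ _ _ _ _ _ H0t Ht1).
Qed.

(** * Goursat's theorem *)

Lemma R_cauchy_limit (x B : nat -> R) : is_lim_seq B 0 ->
  (forall m k, Rabs (x (m + k)%nat - x m) <= B m) ->
  exists l, forall m, Rabs (x m - l) <= B m.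
Proof.
  intros HB Hx.
  assert (Hc : ex_lim_seq_cauchy x).
  { intros [e He]. apply is_lim_seq_spec in HB.
    assert (He2 : 0 < e / 2) by lra.
    destruct (HB (mkposreal _ He2)) as [N HN]. exists N. intros n m Hn Hm. simpl in *.
    specialize (HN N (le_n N)). pose proof (Hx N (n - N)%nat) as H1.
    pose proof (Hx N (m - N)%nat) as H2.
    replace (N + (n - N))%nat with n in H1 by lia. replace (N + (m - N))%nat with m in H2 by lia.
    apply Rabs_le_between in H1, H2. apply Rabs_def2 in HN. apply Rabs_def1; lra. }
  apply ex_lim_seq_cauchy_corr in Hc. destruct Hc as [l Hl]. exists l. intros m.
  refine (is_lim_seq_le (fun k => Rabs (x m - x (k + m)%nat)) (fun _ => B m) (Finite _) (Finite _)
    _ _ (is_lim_seq_const _)).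
  - intros k. rewrite Rabs_minus_sym, Nat.add_comm. apply Hx.
  - apply (is_lim_seq_abs _ (x m - l)%R), is_lim_seq_minus'; [apply is_lim_seq_const|].
    now apply is_lim_seq_incr_n.
Qed.

Lemma C_geometric_limit (u : nat -> C) (K : R) :
  (forall n, Cmod (u (S n) - u n) <= K * (/ 2) ^ n) ->
  exists l, forall n, Cmod (u n - l) <= 4 * K * (/ 2) ^ n.
Proof.
  intros Hu.
  assert (PK : 0 <= K).
  { specialize (Hu O). pose proof (Cmod_ge_0 (u 1%nat - u O)). simpl in Hu. lra. }
  assert (Hc : forall m k, Cmod (u (m + k)%nat - u m) <= 2 * K * (/ 2) ^ m).
  { intros m k. apply Rle_trans with (2 * K * (/ 2) ^ m * (1 - (/ 2) ^ k))%R.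
    - induction k as [|k IH].
      + rewrite Nat.add_0_r, Cmod_minus_self. simpl. lra.
      + rewrite Nat.add_succ_r. specialize (Hu (m + k)%nat). rewrite pow_add in Hu.
        pose proof (Cmod_minus_triangle (u (S (m + k))) (u (m + k)%nat) (u m)). simpl. lra.
    - assert (0 < (/ 2) ^ m) by (apply pow_lt; lra).
      assert (0 < (/ 2) ^ k) by (apply pow_lt; lra).
      assert (0 <= 2 * K * (/ 2) ^ m) by (apply Rmult_le_pos; lra). nra. }
  assert (HB : is_lim_seq (fun m => 2 * K * (/ 2) ^ m)%R 0).
  { replace (Finite 0) with (Rbar_mult (2 * K)%R 0) by (simpl; f_equal; ring).
    apply is_lim_seq_scal_l, is_lim_seq_geom. rewrite Rabs_right; lra. }
  assert (Hcomp : forall z : C, Rabs (fst z) <= Cmod z /\ Rabs (snd z) <= Cmod z).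
  { intros z. pose proof (Rmax_Cmod z). pose proof (Rmax_l (Rabs (fst z)) (Rabs (snd z))).
    pose proof (Rmax_r (Rabs (fst z)) (Rabs (snd z))). lra. }
  destruct (R_cauchy_limit (fun n => fst (u n)) _ HB) as [x Hx].
  { intros m k. eapply Rle_trans; [apply (Hcomp (u (m + k)%nat - u m))|apply Hc]. }
  destruct (R_cauchy_limit (fun n => snd (u n)) _ HB) as [y Hy].
  { intros m k. eapply Rle_trans; [apply (Hcomp (u (m + k)%nat - u m))|apply Hc]. }
  exists (x, y). intros n. eapply Rle_trans; [apply Cmod_le_Rabs|].
  specialize (Hx n). specialize (Hy n). simpl. unfold Rminus in Hx, Hy. lra.
Qed.

Lemma half_pow_lt (K e : R) : 0 < e -> exists n, K * (/ 2) ^ n < e.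
Proof.
  intros He.
  assert (H : is_lim_seq (fun n => K * (/ 2) ^ n)%R 0).
  { replace (Finite 0) with (Rbar_mult K 0) by (simpl; f_equal; ring).
    apply is_lim_seq_scal_l, is_lim_seq_geom. rewrite Rabs_right; lra. }
  apply is_lim_seq_spec in H. destruct (H (mkposreal e He)) as [N HN].
  exists N. specialize (HN N (le_n N)). simpl in HN.
  pose proof (Rle_abs (K * (/ 2) ^ N - 0)). lra.
Qed.

Lemma dyadic_descent (P : C -> R -> Prop) (K : R) :
  (forall a h, P a h -> exists a' h', P a' h' /\ Rabs h' = (Rabs h / 2)%R /\
    Cmod (a' - a) <= K * Rabs h) ->
  forall a h, P a h -> h <> 0%R ->
  exists z, forall d, 0 < d -> exists a' h', P a' h' /\ 0 < Rabs h' < d /\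
    Cmod (a' - z) <= 4 * K * Rabs h'.
Proof.
  intros Hstep a0 h0 H0 Hh0.
  assert (Hnext : forall x : C * R, exists y : C * R, P (fst x) (snd x) ->
    P (fst y) (snd y) /\ Rabs (snd y) = (Rabs (snd x) / 2)%R /\
    Cmod (fst y - fst x) <= K * Rabs (snd x)).
  { intros [a h]. destruct (classic (P a h)) as [H|H]; [|exists (a, h); tauto].
    destruct (Hstep a h H) as (a' & h' & H'). now exists (a', h'). }
  destruct (choice _ Hnext) as [next Hn].
  set (x := fun n => Nat.iter n next (a0, h0)).
  assert (Hx : forall n, P (fst (x n)) (snd (x n)) /\
    Rabs (snd (x n)) = (Rabs h0 * (/ 2) ^ n)%R).
  { induction n as [|n [H1 H2]]; [split; [exact H0|simpl; ring]|].
    destruct (Hn _ H1) as (H3 & H4 & _). split; [exact H3|].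
    change (x (S n)) with (next (x n)). rewrite H4, H2. simpl. field. }
  destruct (C_geometric_limit (fun n => fst (x n)) (K * Rabs h0)) as [z Hz].
  { intros n. destruct (Hx n) as [H1 H2]. destruct (Hn _ H1) as (_ & _ & H5).
    change (x (S n)) with (next (x n)). rewrite H2 in H5. lra. }
  exists z. intros d Hd. destruct (half_pow_lt (Rabs h0) d Hd) as [n Hnd].
  destruct (Hx n) as [H1 H2]. exists (fst (x n)), (snd (x n)). rewrite H2.
  split; [exact H1|]. split.
  - split; [|exact Hnd]. apply Rmult_lt_0_compat; [now apply Rabs_pos_lt|apply pow_lt; lra].
  - specialize (Hz n). simpl in Hz. lra.
Qed.

Definition continuous_on_disk (f : C -> C) : Prop := forall z, in_disk z -> continuous f z.

Lemma in_disk_0 : in_disk 0.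
Proof. unfold in_disk. rewrite Cmod_0. lra. Qed.

Lemma in_disk_seg (a b : C) (t : R) : 0 <= t <= 1 -> in_disk a -> in_disk b -> in_disk (seg a b t).
Proof. apply Cmod_seg_lt. Qed.

Lemma is_derive_0_disk (f : C -> C) (z : C) : (forall w, in_disk w -> is_derive f w (RtoC 0)) ->
  in_disk z -> f z = f 0.
Proof.
  intros Hf Hz. apply is_derive_0_seg. intros t Ht. apply Hf, in_disk_seg; auto using in_disk_0.
Qed.

Lemma continuous_on_disk_seg (f : C -> C) (a b : C) : continuous_on_disk f ->
  in_disk a -> in_disk b -> continuous_on_seg f a b.
Proof. intros Hf Ha Hb t Ht. now apply Hf, in_disk_seg. Qed.

Lemma analytic_is_derive (f : C -> C) (z : C) : analytic_on_disk f -> in_disk z ->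
  is_derive f z (C_derive f z).
Proof. intros Hf Hz. exact (C_derive_correct f z 0 (Hf z Hz)). Qed.

Lemma analytic_continuous (f : C -> C) : analytic_on_disk f -> continuous_on_disk f.
Proof. intros Hf z Hz. eapply is_derive_continuous, analytic_is_derive; [exact Hf|exact Hz]. Qed.

Lemma analytic_mult (f g : C -> C) :
  analytic_on_disk f -> analytic_on_disk g -> analytic_on_disk (fun z => f z * g z).
Proof.
  intros Hf Hg z Hz. eexists. apply is_derive_Cmult; now apply analytic_is_derive.
Qed.

Lemma analytic_pow (f : C -> C) (n : nat) :
  analytic_on_disk f -> analytic_on_disk (fun z => f z ^ n).
Proof.
  intros Hf z Hz. eexists. apply is_derive_Cpow, analytic_is_derive; assumption.
Qed.

Lemma analytic_scal (c : C) (f : C -> C) :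
  analytic_on_disk f -> analytic_on_disk (fun z => c * f z).
Proof. intros Hf z Hz. eexists. now apply is_derive_Cscal, analytic_is_derive. Qed.

Lemma analytic_cexp (f : C -> C) : analytic_on_disk f -> analytic_on_disk (fun z => cexp (f z)).
Proof. intros Hf z Hz. eexists. now apply is_derive_cexp_comp, analytic_is_derive. Qed.

Definition triangle_integral (f : C -> C) (a b c : C) : C :=
  segint f a b + segint f b c + segint f c a.

Section TriangleIntegral.
Variable f : C -> C.
Hypothesis f_cont : continuous_on_disk f.
Variables a b c : C.
Hypotheses (Ha : in_disk a) (Hb : in_disk b) (Hc : in_disk c).

Lemma triangle_integral_subdivide (ab := seg a b (/ 2)%R) (bc := seg b c (/ 2)%R)
    (ca := seg c a (/ 2)%R) :
  triangle_integral f a b c =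
  triangle_integral f a ab ca + triangle_integral f ab b bc +
  triangle_integral f ca bc c + triangle_integral f bc ca ab.
Proof.
  assert (Hab : in_disk ab) by (apply in_disk_seg; auto; lra).
  assert (Hbc : in_disk bc) by (apply in_disk_seg; auto; lra).
  assert (Hca : in_disk ca) by (apply in_disk_seg; auto; lra).
  unfold triangle_integral.
  rewrite (segint_Chasles f a b (/ 2)), (segint_Chasles f b c (/ 2)), (segint_Chasles f c a (/ 2))
    by (lra || now apply continuous_on_disk_seg).
  fold ab bc ca.
  rewrite (segint_swap f ab ca), (segint_swap f ab bc), (segint_swap f bc ca)
    by now apply continuous_on_disk_seg.
  ring.
Qed.

Lemma Cmod_triangle_integral_approx (G g : C -> C) (rho M : R) :
  Cmod (b - a) <= rho -> Cmod (c - a) <= rho ->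
  (forall z, is_derive G z (g z)) -> (forall z, continuous g z) ->
  (forall z, Cmod (z - a) <= rho -> Cmod (f z - g z) <= M) ->
  Cmod (triangle_integral f a b c) <= M * (4 * rho).
Proof.
  intros Hba Hca HG Hg HM.
  assert (Haa : Cmod (a - a) <= rho).
  { rewrite Cmod_minus_self. pose proof (Cmod_ge_0 (b - a)). lra. }
  assert (PM : 0 <= M) by (eapply Rle_trans; [apply Cmod_ge_0|exact (HM a Haa)]).
  assert (Hside : forall p q, in_disk p -> in_disk q ->
    Cmod (p - a) <= rho -> Cmod (q - a) <= rho ->
    Cmod (segint f p q - (G q - G p)) <= M * Cmod (q - p)).
  { intros p q Hp Hq Hpa Hqa.
    assert (Hf := continuous_on_disk_seg f p q f_cont Hp Hq).
    assert (Hg' : continuous_on_seg g p q) by (intros t _; apply Hg).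
    rewrite <- (segint_derive G g p q), <- segint_minus by auto.
    apply Cmod_segint_le.
    - intros t Ht. apply continuous_Cminus; [now apply Hf|apply Hg].
    - intros t Ht. apply HM. rewrite seg_minus. now apply Cmod_seg_le. }
  specialize (Hside a b Ha Hb Haa Hba) as Hab. specialize (Hside b c Hb Hc Hba Hca) as Hbc.
  specialize (Hside c a Hc Ha Hca Haa) as Hac.
  unfold triangle_integral.
  replace (segint f a b + segint f b c + segint f c a) with
    ((segint f a b - (G b - G a)) + (segint f b c - (G c - G b)) + (segint f c a - (G a - G c)))
    by ring.
  eapply Rle_trans; [apply Cmod_triangle|].
  eapply Rle_trans; [apply Rplus_le_compat_r, Cmod_triangle|].
  assert (Hcb : Cmod (c - b) <= 2 * rho).
  { pose proof (Cmod_minus_triangle c a b) as H. rewrite (Cmod_minus_sym a b) in H. lra. }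
  rewrite (Cmod_minus_sym a c) in Hac. nra.
Qed.

End TriangleIntegral.

(* The four midpoint triangles of the triangle at [a] with edges [h u] and [h v] are of the same
   form, with [h] replaced by [h / 2] or, for the inner one, by [- h / 2]. *)
Definition scaled_triangle_integral (f : C -> C) (u v a : C) (h : R) : C :=
  triangle_integral f a (a + h * u) (a + h * v).

Definition scaled_triangle_within (M : R) (u v a : C) (h : R) : Prop :=
  Cmod a <= M /\ Cmod (a + h * u) <= M /\ Cmod (a + h * v) <= M.

Section ScaledTriangle.
Variables (f : C -> C) (M : R) (u v : C).
Hypothesis f_cont : continuous_on_disk f.
Hypothesis M_lt_1 : M < 1.

Lemma scaled_triangle_within_midpoints (a : C) (k : R) : scaled_triangle_within M u v a (2 * k) ->
  scaled_triangle_within M u v a k /\ scaled_triangle_within M u v (a + k * u) k /\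
  scaled_triangle_within M u v (a + k * v) k /\
  scaled_triangle_within M u v (a + k * u + k * v) (- k).
Proof.
  unfold scaled_triangle_within. rewrite RtoC_mult, RtoC_opp. intros (Ha & Hu & Hv).
  assert (Hmid : forall p q r, Cmod p <= M -> Cmod q <= M -> r = (p + q) / 2 -> Cmod r <= M).
  { intros p q r Hp Hq ->. replace ((p + q) / 2) with (seg p q (/ 2)%R).
    - apply Cmod_seg_le; auto; lra.
    - unfold seg. rewrite RtoC_inv by lra. field. }
  assert (Hab : Cmod (a + k * u) <= M) by (apply (Hmid _ _ _ Ha Hu); field).
  assert (Hac : Cmod (a + k * v) <= M) by (apply (Hmid _ _ _ Ha Hv); field).
  assert (Hbc : Cmod (a + k * u + k * v) <= M) by (apply (Hmid _ _ _ Hu Hv); field).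
  replace (a + k * u + k * u) with (a + 2 * k * u) by ring.
  replace (a + k * v + k * u) with (a + k * u + k * v) by ring.
  replace (a + k * v + k * v) with (a + 2 * k * v) by ring.
  replace (a + k * u + k * v + - k * u) with (a + k * v) by ring.
  replace (a + k * u + k * v + - k * v) with (a + k * u) by ring.
  tauto.
Qed.

Lemma scaled_triangle_integral_midpoints (a : C) (k : R) :
  scaled_triangle_within M u v a (2 * k) ->
  scaled_triangle_integral f u v a (2 * k) =
  scaled_triangle_integral f u v a k + scaled_triangle_integral f u v (a + k * u) k +
  scaled_triangle_integral f u v (a + k * v) k +
  scaled_triangle_integral f u v (a + k * u + k * v) (- k).
Proof.
  intros (Ha & Hu & Hv). unfold scaled_triangle_integral.
  rewrite triangle_integral_subdivide by (unfold in_disk; auto; lra).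
  f_equal; [f_equal; [f_equal|]|]; f_equal; unfold seg;
    rewrite ?RtoC_opp, ?RtoC_mult, ?RtoC_inv by lra; field.
Qed.

Lemma scaled_triangle_descent (eta : R) (a : C) (h : R) :
  scaled_triangle_within M u v a h -> eta * h ^ 2 <= Cmod (scaled_triangle_integral f u v a h) ->
  exists a' h', (scaled_triangle_within M u v a' h' /\
      eta * h' ^ 2 <= Cmod (scaled_triangle_integral f u v a' h')) /\
    Rabs h' = (Rabs h / 2)%R /\ Cmod (a' - a) <= (Cmod u + Cmod v) * Rabs h.
Proof.
  intros Hin Heta.
  set (k := (h / 2)%R). assert (Hk : h = (2 * k)%R) by (unfold k; field). clearbody k. subst h.
  rewrite Rabs_mult, (Rabs_right 2) by lra.
  destruct (scaled_triangle_within_midpoints a k Hin) as (H1 & H2 & H3 & H4).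
  rewrite (scaled_triangle_integral_midpoints a k Hin) in Heta.
  match type of Heta with _ <= Cmod (?p + ?q + ?r + ?s) =>
    pose proof (Cmod_triangle (p + q + r) s); pose proof (Cmod_triangle (p + q) r);
    pose proof (Cmod_triangle p q);
    assert (Hlarge : eta * k ^ 2 <= Cmod p \/ eta * k ^ 2 <= Cmod q \/
      eta * k ^ 2 <= Cmod r \/ eta * k ^ 2 <= Cmod s) by lra end.
  pose proof (Cmod_ge_0 (k * u)) as Pu. pose proof (Cmod_ge_0 (k * v)) as Pv.
  pose proof (Cmod_triangle (k * u) (k * v)) as Huv.
  assert (Huk : Cmod (k * u) = (Rabs k * Cmod u)%R) by now rewrite Cmod_mult, Cmod_R.
  assert (Hvk : Cmod (k * v) = (Rabs k * Cmod v)%R) by now rewrite Cmod_mult, Cmod_R.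
  destruct Hlarge as [Hbig|[Hbig|[Hbig|Hbig]]].
  - exists a, k. rewrite Cmod_minus_self. repeat split; try apply H1; lra.
  - exists (a + k * u), k. replace (a + k * u - a) with (k * u) by ring.
    repeat split; try apply H2; lra.
  - exists (a + k * v), k. replace (a + k * v - a) with (k * v) by ring.
    repeat split; try apply H3; lra.
  - exists (a + k * u + k * v), (- k)%R. rewrite Rabs_Ropp.
    replace (a + k * u + k * v - a) with (k * u + k * v) by ring.
    replace ((- k) ^ 2)%R with (k ^ 2)%R by ring. repeat split; try apply H4; lra.
Qed.

(* Affine functions integrate to zero, and [f] is affine up to [o(|h|)] on the triangle. *)
Lemma scaled_triangle_integral_small (z l : C) (e : R) : is_derive f z l -> 0 < e ->
  exists d, 0 < d /\ forall a h, Rabs h < d -> scaled_triangle_within M u v a h ->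
    Cmod (a - z) <= 4 * (Cmod u + Cmod v) * Rabs h ->
    Cmod (scaled_triangle_integral f u v a h) <= e * h ^ 2.
Proof.
  intros Hl He. set (K := (Cmod u + Cmod v)%R).
  pose proof (Cmod_ge_0 u) as Pu. pose proof (Cmod_ge_0 v) as Pv.
  assert (PK : 0 <= K) by (unfold K; lra).
  set (e' := (e / (20 * K ^ 2 + 1))%R).
  assert (He' : 0 < e') by (apply Rdiv_lt_0_compat; nra).
  destruct (proj1 (is_derive_Cmod f z l) Hl e' He') as (d & Hd & Hf).
  exists (d / (5 * K + 1))%R. split; [apply Rdiv_lt_0_compat; lra|].
  intros a h Hh (Ha & Hu & Hv) Haz. apply Rlt_div_r in Hh; [|lra].
  pose proof (Rabs_pos h) as Ph.
  assert (Hedge : forall w, Cmod w <= K -> Cmod (a + h * w - a) <= K * Rabs h).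
  { intros w Hw. replace (a + h * w - a) with (w * h) by ring.
    rewrite Cmod_mult, Cmod_R. now apply Rmult_le_compat_r. }
  apply Rle_trans with (e' * (5 * K * Rabs h) * (4 * (K * Rabs h)))%R.
  - apply (Cmod_triangle_integral_approx f f_cont) with
      (G := fun w => f z * w + l * (w * w / 2 - z * w)) (g := fun w => f z + l * (w - z)).
    1-3: unfold in_disk; lra.
    1-2: apply Hedge; unfold K; lra.
    + intros w. eapply is_derive_Ceq.
      * apply is_derive_Cplus; [apply is_derive_Cscal, is_derive_Cid|]. apply is_derive_Cscal.
        apply is_derive_Cminus; [|apply is_derive_Cscal, is_derive_Cid].
        apply is_derive_Cmult; [|apply is_derive_Cconst].
        apply is_derive_Cmult; apply is_derive_Cid.
      * cbv beta. field.
    + intros w. eapply is_derive_continuous, is_derive_Cplus; [apply is_derive_Cconst|].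
      apply is_derive_Cscal, is_derive_Cminus; [apply is_derive_Cid|apply is_derive_Cconst].
    + intros w Hw. pose proof (Cmod_minus_triangle w a z).
      replace (f w - (f z + l * (w - z))) with (f w - f z - l * (w - z)) by ring.
      eapply Rle_trans; [apply Hf; fold K in Haz; lra|].
      apply Rmult_le_compat_l; fold K in Haz; lra.
  - replace (e' * (5 * K * Rabs h) * (4 * (K * Rabs h)))%R with (e' * (20 * K ^ 2) * Rabs h ^ 2)%R
      by ring.
    rewrite pow2_abs. apply Rmult_le_compat_r; [apply pow2_ge_0|].
    unfold e', Rdiv. rewrite Rmult_assoc. rewrite <- (Rmult_1_r e) at 2.
    apply Rmult_le_compat_l; [lra|]. rewrite Rmult_comm. apply Rle_div_l; nra.
Qed.

End ScaledTriangle.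

Lemma goursat (f : C -> C) (a b c : C) : analytic_on_disk f ->
  in_disk a -> in_disk b -> in_disk c -> triangle_integral f a b c = 0.
Proof.
  intros Hf Ha Hb Hc. assert (Hcont := analytic_continuous f Hf).
  set (u := b - a). set (v := c - a). set (K := (Cmod u + Cmod v)%R).
  assert (PK : 0 <= K) by (pose proof (Cmod_ge_0 u); pose proof (Cmod_ge_0 v); unfold K; lra).
  set (M := Rmax (Cmod a) (Rmax (Cmod b) (Cmod c))).
  assert (HM : M < 1) by (repeat apply Rmax_lub_lt; assumption).
  assert (Eb : a + RtoC 1 * u = b) by (unfold u; ring).
  assert (Ec : a + RtoC 1 * v = c) by (unfold v; ring).
  apply Cmod_eq_0, Rle_antisym; [|apply Cmod_ge_0]. apply Rnot_lt_le. intros Hpos.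
  set (eta := Cmod (triangle_integral f a b c)) in *.
  destruct (dyadic_descent (fun a h => scaled_triangle_within M u v a h /\
    eta * h ^ 2 <= Cmod (scaled_triangle_integral f u v a h)) K) with (a := a) (h := 1%R)
    as [z Hz].
  - intros a' h [H1 H2]. now apply scaled_triangle_descent.
  - split.
    + unfold scaled_triangle_within. rewrite Eb, Ec. unfold M. repeat split.
      * apply Rmax_l.
      * eapply Rle_trans; [apply Rmax_l|apply Rmax_r].
      * eapply Rle_trans; [apply Rmax_r|apply Rmax_r].
    + unfold scaled_triangle_integral. rewrite Eb, Ec. fold eta. lra.
  - lra.
  - assert (Hzd : in_disk z).
    { destruct (Hz ((1 - M) / (4 * K + 1))%R) as (a' & h & [[Ha' _] _] & [_ Hh] & Haz).
      { apply Rdiv_lt_0_compat; lra. }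
      apply Rlt_div_r in Hh; [|lra]. pose proof (Rabs_pos h).
      pose proof (Cmod_triangle_inv z a') as Hinv. rewrite Cmod_minus_sym in Hinv.
      unfold in_disk. lra. }
    destruct (scaled_triangle_integral_small f M u v Hcont HM z _ (eta / 2)
      (analytic_is_derive f z Hf Hzd)) as (d & Hd & Hsmall); [lra|].
    destruct (Hz d Hd) as (a' & h & [Hin Heta] & [Hh0 Hhd] & Haz).
    specialize (Hsmall a' h Hhd Hin Haz).
    assert (0 < h ^ 2) by (rewrite <- pow2_abs; nra). nra.
Qed.

Lemma is_derive_segint (f : C -> C) (a z : C) : analytic_on_disk f -> in_disk a -> in_disk z ->
  is_derive (segint f a) z (f z).
Proof.
  intros Hf Ha Hz. assert (Hcont := analytic_continuous f Hf).
  apply is_derive_Cmod. intros e He.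
  destruct (proj1 (continuous_Cmod f z) (Hcont z Hz) e He) as (d & Hd & Hfz).
  exists (Rmin d (1 - Cmod z)). split; [apply Rmin_glb_lt; unfold in_disk in Hz; lra|].
  intros w Hw. apply Rmin_Rgt_l in Hw as [Hw1 Hw2].
  assert (Hwd : in_disk w) by (pose proof (Cmod_triangle_inv w z); unfold in_disk; lra).
  assert (Hzw := continuous_on_disk_seg f z w Hcont Hz Hwd).
  assert (Hprim : segint f a w - segint f a z = segint f z w).
  { pose proof (goursat f a z w Hf Ha Hz Hwd) as HT. unfold triangle_integral in HT.
    rewrite (segint_swap f a w) in HT by now apply continuous_on_disk_seg.
    apply Cminus_eq_0. rewrite <- Copp_0, <- HT. ring. }
  rewrite Hprim. apply Cmod_segint_minus_le; [exact Hzw|].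
  intros t Ht. left. apply Hfz. rewrite seg_minus. apply Cmod_seg_lt; [exact Ht| |exact Hw1].
  rewrite Cmod_minus_self. exact Hd.
Qed.

(** * Cauchy's formula *)

Lemma closed_disk_uniform_radius (M : R) (P : R -> C -> Prop) :
  (forall d e z, 0 < d <= e -> P e z -> P d z) ->
  (forall z, Cmod z <= M -> exists d, 0 < d /\
     forall w, Cmod w <= M -> Cmod (w - z) < d -> P d w) ->
  exists d, 0 < d /\ forall z, Cmod z <= M -> P d z.
Proof.
  intros Hmono Hloc.
  assert (H : forall z : C, exists d : posreal,
    forall w, Cmod w <= M -> Cmod (w - z) < 2 * d -> P d w).
  { intros z. destruct (Rle_lt_dec (Cmod z) M) as [Hz|Hz].
    - destruct (Hloc z Hz) as (d & Hd & HP). assert (Hd2 : 0 < d / 2) by lra.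
      exists (mkposreal _ Hd2). simpl. intros w Hw Hwz.
      apply Hmono with d; [lra|]. apply HP; [exact Hw|lra].
    - assert (Hd : 0 < (Cmod z - M) / 2) by lra. exists (mkposreal _ Hd). simpl.
      intros w Hw Hwz. pose proof (Cmod_triangle_inv z w). rewrite Cmod_minus_sym in Hwz. lra. }
  destruct (choice _ H) as [delta Hdelta].
  destruct (compactness_value_2d (- M) M (- M) M (fun x y => delta (x, y))) as [d Hd].
  exists d. split; [apply cond_pos|]. intros [x y] Hz. apply NNPP. intros Hn.
  pose proof (Rmax_Cmod (x, y)) as Hm. simpl in Hm.
  pose proof (Rmax_l (Rabs x) (Rabs y)). pose proof (Rmax_r (Rabs x) (Rabs y)).
  apply (Hd x y); [apply Rabs_le_between; lra|apply Rabs_le_between; lra|].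
  intros (s & t & _ & _ & Hs & Ht & Hdd). apply Hn.
  apply Hmono with (delta (s, t)); [split; [apply cond_pos|exact Hdd]|].
  apply Hdelta; [exact Hz|].
  eapply Rle_lt_trans; [apply Cmod_le_Rabs|]. simpl. unfold Rminus in Hs, Ht. lra.
Qed.

Definition circ (r : R) (t : C) : C := r * cexp (Ci * t).

Lemma is_derive_circ (r : R) (t : C) : is_derive (circ r) t (Ci * circ r t).
Proof.
  eapply is_derive_Ceq.
  - apply is_derive_Cscal, is_derive_cexp_comp, is_derive_Cscal, is_derive_Cid.
  - unfold circ. ring.
Qed.

Lemma Cmod_circ (r t : R) : 0 <= r -> Cmod (circ r t) = r.
Proof.
  intros Hr. unfold circ. rewrite Cmod_mult, Cmod_R, Cmod_cexp, Rabs_right by lra.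
  replace (Re (Ci * t)) with 0%R by (simpl; ring). rewrite exp_0. ring.
Qed.

Lemma cexp_2PI : cexp (0, (2 * PI)%R) = 1.
Proof. unfold cexp. simpl. rewrite exp_0, cos_2PI, sin_2PI. unfold RtoC. f_equal; ring. Qed.

Lemma circ_2PI (r : R) : circ r (2 * PI)%R = circ r 0.
Proof.
  unfold circ. replace (Ci * (2 * PI)%R) with ((0, 2 * PI)%R : C).
  - rewrite cexp_2PI. replace (Ci * 0) with (RtoC 0) by ring. now rewrite cexp_0.
  - apply injective_projections; simpl; ring.
Qed.

Lemma Ci_neq_0 : Ci <> 0.
Proof. apply Cmod_gt_0. rewrite Cmod_Ci. lra. Qed.

Lemma RtoC_2PI_neq_0 : RtoC (2 * PI) <> 0.
Proof. apply RtoC_neq_0. pose proof PI_RGT_0. lra. Qed.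

Definition circle_mean (r : R) (g : C -> C) : C :=
  / RtoC (2 * PI) * CRInt (fun t => g (circ r t)) 0 (2 * PI).

Definition continuous_on_circle (r : R) (g : C -> C) : Prop :=
  forall w, Cmod w = r -> continuous g w.

Section CircleMean.
Variable r : R.
Hypothesis r_pos : 0 < r.
Implicit Types (f g : C -> C) (c : C).

Lemma is_CRInt_circle_mean g : continuous_on_circle r g ->
  is_CRInt (fun t => g (circ r t)) 0 (2 * PI) (RtoC (2 * PI) * circle_mean r g).
Proof.
  intros Hg. pose proof PI_RGT_0. unfold circle_mean.
  rewrite Cmult_assoc, Cinv_r, Cmult_1_l by exact RtoC_2PI_neq_0.
  apply is_CRInt_CRInt; [lra|]. intros t _.
  apply (continuous_Ccomp g (fun t : R => circ r t)).
  - apply (continuous_Ccomp (circ r) RtoC); [apply continuous_RtoC|].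
    eapply is_derive_continuous, is_derive_circ.
  - apply Hg, Cmod_circ. lra.
Qed.

Lemma circle_mean_unique g (l : C) :
  is_CRInt (fun t => g (circ r t)) 0 (2 * PI) (RtoC (2 * PI) * l) -> circle_mean r g = l.
Proof.
  intros H. apply (@is_RInt_unique C_R_CompleteNormedModule) in H. unfold circle_mean.
  rewrite H. field. exact RtoC_2PI_neq_0.
Qed.

Lemma circle_mean_ext f g : (forall w, Cmod w = r -> f w = g w) ->
  circle_mean r f = circle_mean r g.
Proof.
  intros H. unfold circle_mean. f_equal. apply RInt_ext. intros t _. apply H, Cmod_circ. lra.
Qed.

Lemma circle_mean_minus f g : continuous_on_circle r f -> continuous_on_circle r g ->
  circle_mean r (fun w => f w - g w) = circle_mean r f - circle_mean r g.
Proof.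
  intros Hf Hg. apply circle_mean_unique.
  replace (RtoC (2 * PI) * (circle_mean r f - circle_mean r g)) with
    (RtoC (2 * PI) * circle_mean r f - RtoC (2 * PI) * circle_mean r g) by ring.
  exact (@is_RInt_minus C_R_NormedModule _ _ _ _ _ _
    (is_CRInt_circle_mean f Hf) (is_CRInt_circle_mean g Hg)).
Qed.

Lemma circle_mean_scal c g : continuous_on_circle r g ->
  circle_mean r (fun w => c * g w) = c * circle_mean r g.
Proof.
  intros Hg. apply circle_mean_unique.
  replace (RtoC (2 * PI) * (c * circle_mean r g)) with (c * (RtoC (2 * PI) * circle_mean r g))
    by ring.
  now apply is_CRInt_scal, is_CRInt_circle_mean.
Qed.

Lemma Cmod_circle_mean_le g (M : R) : continuous_on_circle r g ->
  (forall w, Cmod w = r -> Cmod (g w) <= M) -> Cmod (circle_mean r g) <= M.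
Proof.
  intros Hg HM. pose proof PI_RGT_0.
  apply Rmult_le_reg_l with (2 * PI)%R; [lra|].
  replace (2 * PI * M)%R with ((2 * PI - 0) * M)%R by ring.
  replace (2 * PI * Cmod (circle_mean r g))%R with (Cmod (RtoC (2 * PI) * circle_mean r g)).
  - refine (Cmod_is_CRInt_le _ 0 (2 * PI) _ _ _ _ (is_CRInt_circle_mean g Hg)); [lra|].
    intros t _. apply HM, Cmod_circ. lra.
  - rewrite Cmod_mult, Cmod_R, Rabs_right; lra.
Qed.

Lemma circle_mean_const c : circle_mean r (fun _ => c) = c.
Proof.
  apply circle_mean_unique. pose proof PI_RGT_0.
  replace (RtoC (2 * PI) * c) with (c * RtoC (2 * PI) - c * RtoC 0) by ring.
  apply (is_CRInt_derive (fun t => c * t) (fun _ => c)); [lra|..]; intros t _.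
  - eapply is_derive_Ceq; [apply is_derive_Cscal, is_derive_Cid|ring].
  - apply continuous_const.
Qed.

(* [i w g(w) dt] is the differential of [G] along the circle. *)
Lemma circle_mean_derive (G g : C -> C) : (forall w, Cmod w = r -> is_derive G w (g w)) ->
  continuous_on_circle r g -> circle_mean r (fun w => w * g w) = 0.
Proof.
  intros HG Hg. apply circle_mean_unique. pose proof PI_RGT_0.
  assert (Hr : forall t : R, Cmod (circ r t) = r) by (intros t; apply Cmod_circ; lra).
  replace (RtoC (2 * PI) * 0) with
    (/ Ci * G (circ r (2 * PI)%R) - / Ci * G (circ r 0)) by (rewrite circ_2PI; ring).
  apply (is_CRInt_derive (fun t => / Ci * G (circ r t)) (fun t => circ r t * g (circ r t)));
    [lra|..]; intros t _.
  - eapply is_derive_Ceq.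
    + apply is_derive_Cscal, is_derive_Ccomp; [apply HG, Hr|apply is_derive_circ].
    + field. exact Ci_neq_0.
  - assert (Hc : continuous (circ r) (RtoC t)) by (eapply is_derive_continuous, is_derive_circ).
    apply continuous_Cmult; [exact Hc|]. apply continuous_Ccomp; [exact Hc|apply Hg, Hr].
Qed.

Lemma continuous_circle_uniform (k : C -> C -> C) (a : C) (e : R) : 0 < e ->
  (forall w, Cmod w = r -> continuous (fun p : C * C => k (fst p) (snd p)) (a, w)) ->
  exists d, 0 < d /\ forall b w, Cmod (b - a) < d -> Cmod w = r -> Cmod (k b w - k a w) <= e.
Proof.
  intros He Hk.
  destruct (closed_disk_uniform_radius r
    (fun d w => Cmod w = r -> forall b, Cmod (b - a) < d -> Cmod (k b w - k a w) <= e))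
    as (d & Hd & Hunif).
  - intros d d' w Hd Hw Hwr b Hb. apply Hw; [exact Hwr|lra].
  - intros z Hz. destruct (Rle_lt_or_eq_dec _ _ Hz) as [Hzr|Hzr].
    + exists (r - Cmod z)%R. split; [lra|]. intros w _ Hwz Hwr.
      pose proof (Cmod_triangle_inv w z). lra.
    + destruct (continuous_Cmod_pair k a z (Hk z Hzr) (e / 2)) as (d & Hd & Hdz); [lra|].
      exists d. split; [exact Hd|]. intros w _ Hwz _ b Hb.
      pose proof (Hdz b w Hb Hwz) as H1. pose proof (Hdz a w) as H2.
      rewrite Cmod_minus_self in H2. specialize (H2 Hd Hwz).
      pose proof (Cmod_minus_triangle (k b w) (k a z) (k a w)) as H3.
      rewrite (Cmod_minus_sym (k a z)) in H3. lra.
  - exists d. split; [exact Hd|]. intros b w Hb Hw. apply Hunif; auto. lra.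
Qed.

Lemma is_derive_circle_mean (k k1 : C -> C -> C) (a : C) (rho : R) : 0 < rho ->
  (forall b w, Cmod (b - a) < rho -> Cmod w = r -> is_derive (fun c => k c w) b (k1 b w)) ->
  (forall b w, Cmod (b - a) < rho -> Cmod w = r ->
     continuous (fun p : C * C => k1 (fst p) (snd p)) (b, w)) ->
  (forall b, Cmod (b - a) < rho -> continuous_on_circle r (k b)) ->
  is_derive (fun b => circle_mean r (k b)) a (circle_mean r (k1 a)).
Proof.
  intros Hrho Hk Hk1 Hc.
  assert (Ha : Cmod (a - a) < rho) by now rewrite Cmod_minus_self.
  assert (Hcb : forall b w, Cmod (b - a) < rho -> Cmod w = r -> continuous (fun c => k1 c w) b).
  { intros b w Hb Hw. apply (continuous_comp_2 (fun c : C => c) (fun _ : C => w) k1).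
    - apply continuous_id.
    - apply continuous_const.
    - now apply Hk1. }
  assert (Hca : continuous_on_circle r (k1 a)).
  { intros w Hw. apply (continuous_comp_2 (fun _ : C => a) (fun v : C => v) k1).
    - apply continuous_const.
    - apply continuous_id.
    - now apply Hk1. }
  assert (Hka := Hc a Ha).
  apply is_derive_Cmod. intros e He.
  destruct (continuous_circle_uniform k1 a e He (fun w => Hk1 a w Ha)) as (d & Hd & Hunif).
  exists (Rmin d rho). split; [now apply Rmin_glb_lt|].
  intros b Hb. apply Rmin_Rgt_l in Hb as [Hbd Hbr]. assert (Hkb := Hc b Hbr).
  assert (Hseg : forall t : R, 0 <= t <= 1 -> forall D, 0 < D -> Cmod (b - a) < D ->
    Cmod (seg a b t - a) < D).
  { intros t Ht D HD Hb. rewrite seg_minus. apply Cmod_seg_lt; auto.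
    now rewrite Cmod_minus_self. }
  assert (Hdiff : continuous_on_circle r (fun w => k b w - k a w)).
  { intros w Hw. apply continuous_Cminus; [now apply Hkb|now apply Hka]. }
  assert (Hlin : continuous_on_circle r (fun w => (b - a) * k1 a w)).
  { intros w Hw. apply continuous_Cmult; [apply continuous_const|now apply Hca]. }
  rewrite (Cmult_comm (circle_mean r (k1 a))), <- circle_mean_scal, <- !circle_mean_minus
    by assumption.
  apply Cmod_circle_mean_le.
  - intros w Hw. apply continuous_Cminus; [now apply Hdiff|now apply Hlin].
  - intros w Hw. rewrite (Cmult_comm (b - a)).
    apply (Cmod_increment_le (fun c => k c w) (fun c => k1 c w)); intros t Ht.
    + apply Hk; auto.
    + apply Hcb; auto.
    + apply Hunif; auto.
Qed.

End CircleMean.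

Definition cauchy_transform (r : R) (phi : C -> C) (n : nat) (a : C) : C :=
  circle_mean r (fun w => phi w * (/ (w - a)) ^ S n).

Section CauchyTransform.
Variable r : R.
Hypothesis r_pos : 0 < r.

Lemma circle_minus_neq_0 (a w : C) : Cmod a < r -> Cmod w = r -> w - a <> 0.
Proof. intros Ha Hw. apply Cmod_gt_0. pose proof (Cmod_triangle_inv w a). lra. Qed.

Lemma continuous_cauchy_kernel (a : C) (n : nat) : Cmod a < r ->
  continuous_on_circle r (fun w => (/ (w - a)) ^ n).
Proof.
  intros Ha w Hw. apply continuous_Cpow, continuous_Cinv; [|now apply circle_minus_neq_0].
  apply continuous_Cminus; [apply continuous_id|apply continuous_const].
Qed.

Lemma is_derive_cauchy_transform (phi : C -> C) (n : nat) (a : C) :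
  continuous_on_circle r phi -> Cmod a < r ->
  is_derive (cauchy_transform r phi n) a (INR (S n) * cauchy_transform r phi (S n) a).
Proof.
  intros Hphi Ha.
  assert (Hb : forall b, Cmod (b - a) < r - Cmod a -> Cmod b < r).
  { intros b Hb. pose proof (Cmod_triangle_inv b a). lra. }
  assert (Hker : forall b m, Cmod b < r ->
    continuous_on_circle r (fun w => phi w * (/ (w - b)) ^ m)).
  { intros b m Hb' w Hw. apply continuous_Cmult; [now apply Hphi|].
    now apply continuous_cauchy_kernel. }
  unfold cauchy_transform at 2. rewrite <- circle_mean_scal by auto.
  apply (is_derive_circle_mean r r_pos (fun b w => phi w * (/ (w - b)) ^ S n)
    (fun b w => INR (S n) * (phi w * (/ (w - b)) ^ S (S n))) a (r - Cmod a)).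
  - lra.
  - intros b w Hba Hw. assert (Hwb := circle_minus_neq_0 b w (Hb b Hba) Hw).
    eapply is_derive_Ceq.
    + apply is_derive_Cscal, is_derive_Cpow, is_derive_Cinv_comp; [|exact Hwb].
      apply is_derive_Cminus; [apply is_derive_Cconst|apply is_derive_Cid].
    + cbn [pred]. rewrite !Cpow_S. field. exact Hwb.
  - intros b w Hba Hw. assert (Hwb := circle_minus_neq_0 b w (Hb b Hba) Hw).
    assert (Hs : continuous (fun p : C * C => snd p) (b, w)) by apply continuous_snd.
    apply continuous_Cmult; [apply continuous_const|].
    apply continuous_Cmult; [apply (continuous_Ccomp phi snd); [exact Hs|now apply Hphi]|].
    apply continuous_Cpow, continuous_Cinv; [|exact Hwb].
    apply continuous_Cminus; [exact Hs|apply continuous_fst].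
  - intros b Hba. now apply Hker, Hb.
Qed.

Lemma circle_mean_winding (a : C) : Cmod a < r -> cauchy_transform r (fun w => w) 0 a = 1.
Proof.
  intros Ha.
  assert (Hid : continuous_on_circle r (fun w => w)) by (intros w _; apply continuous_id).
  transitivity (cauchy_transform r (fun w => w) 0 0).
  - apply is_derive_0_seg. intros t Ht.
    assert (Hs : Cmod (seg 0 a t) < r) by (apply Cmod_seg_lt; auto; rewrite Cmod_0; lra).
    eapply is_derive_Ceq; [now apply is_derive_cauchy_transform|].
    set (b := seg 0 a t) in *.
    replace (cauchy_transform r (fun w => w) 1 b) with (RtoC 0); [simpl; ring|]. symmetry.
    apply (circle_mean_derive r r_pos (fun w => - / (w - b))).
    + intros w Hw. assert (Hwb := circle_minus_neq_0 b w Hs Hw). eapply is_derive_Ceq.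
      * apply is_derive_Copp, is_derive_Cinv_comp; [|exact Hwb].
        apply is_derive_Cminus; [apply is_derive_Cid|apply is_derive_Cconst].
      * simpl. field. exact Hwb.
    + now apply continuous_cauchy_kernel.
  - rewrite <- (circle_mean_const r 1). apply circle_mean_ext; [exact r_pos|].
    intros w Hw. simpl. field. apply Cmod_gt_0. lra.
Qed.

End CauchyTransform.

Section CauchyFormula.
Variables (f f1 : C -> C).
Hypothesis f_derive : forall z, in_disk z -> is_derive f z (f1 z).
Hypothesis f1_cont : continuous_on_disk f1.
Variables (r : R) (a : C).
Hypothesis r_bounds : 0 < r < 1.
Hypothesis a_lt_r : Cmod a < r.

Let dilation (s : C) : C := circle_mean r (fun w => f (seg a w s) * (w * / (w - a))).

Lemma in_disk_seg_circle (w : C) (t : R) : Cmod w = r -> 0 <= t <= 1 -> in_disk (seg a w t).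
Proof. intros Hw Ht. apply Rle_lt_trans with r; [apply Cmod_seg_le|]; lra. Qed.

Lemma circle_mean_dilation_derive (t : R) : 0 <= t <= 1 ->
  circle_mean r (fun w => w * f1 (seg a w t)) = 0.
Proof.
  intros Ht. assert (Hseg : forall w, Cmod w = r -> in_disk (seg a w t)).
  { intros w Hw. now apply in_disk_seg_circle. }
  assert (Hd : forall w, is_derive (fun w => seg a w t) w (RtoC t)).
  { intros w. eapply is_derive_Ceq.
    - apply is_derive_Cplus; [apply is_derive_Cconst|]. apply is_derive_Cscal.
      apply is_derive_Cminus; [apply is_derive_Cid|apply is_derive_Cconst].
    - ring. }
  assert (Hc : continuous_on_circle r (fun w => f1 (seg a w t))).
  { intros w Hw. apply continuous_Ccomp; [eapply is_derive_continuous, Hd|].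
    now apply f1_cont, Hseg. }
  destruct (Req_dec t 0) as [->|Ht0].
  - apply (circle_mean_derive r (proj1 r_bounds) (fun w => f1 a * w)); [|exact Hc].
    intros w Hw. rewrite seg_0.
    eapply is_derive_Ceq; [apply is_derive_Cscal, is_derive_Cid|ring].
  - apply (circle_mean_derive r (proj1 r_bounds) (fun w => / RtoC t * f (seg a w t))); [|exact Hc].
    intros w Hw. eapply is_derive_Ceq.
    + apply is_derive_Cscal, is_derive_Ccomp; [now apply f_derive, Hseg|apply Hd].
    + field. now apply RtoC_neq_0.
Qed.

Lemma is_derive_dilation (t : R) : 0 <= t <= 1 -> is_derive dilation (RtoC t) (RtoC 0).
Proof.
  intros Ht. rewrite <- (circle_mean_dilation_derive t Ht).
  assert (Hrho : 0 < (1 - r) / (2 * r)) by (apply Rdiv_lt_0_compat; lra).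
  assert (Hseg : forall b w, Cmod (b - t) < (1 - r) / (2 * r) -> Cmod w = r -> in_disk (seg a w b)).
  { intros b w Hb Hw. apply Rlt_div_r in Hb; [|lra].
    assert (Hdisk : Cmod (seg a w t) <= r) by (apply Cmod_seg_le; lra).
    assert (Hdiff : Cmod (seg a w b - seg a w t) <= Cmod (b - t) * (2 * r)).
    { replace (seg a w b - seg a w t) with ((b - t) * (w - a)) by (unfold seg; ring).
      apply Cmod_mult_le; [lra|]. pose proof (Cmod_minus_le w a). lra. }
    pose proof (Cmod_triangle_inv (seg a w b) (seg a w t)). unfold in_disk. lra. }
  apply (is_derive_circle_mean r (proj1 r_bounds) (fun b w => f (seg a w b) * (w * / (w - a)))
    (fun b w => w * f1 (seg a w b)) (RtoC t) _ Hrho).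
  - intros b w Hb Hw. assert (Hwa := circle_minus_neq_0 r a w a_lt_r Hw). eapply is_derive_Ceq.
    + apply is_derive_Cmult; [|apply is_derive_Cconst].
      apply is_derive_Ccomp; [now apply f_derive, Hseg|apply is_derive_seg].
    + cbv beta. field. exact Hwa.
  - intros b w Hb Hw.
    assert (Hs : continuous (fun p : C * C => snd p) (b, w)) by apply continuous_snd.
    apply continuous_Cmult; [exact Hs|].
    apply (continuous_Ccomp f1 (fun p : C * C => seg a (snd p) (fst p)));
      [|now apply f1_cont, Hseg].
    apply continuous_Cplus; [apply continuous_const|].
    apply continuous_Cmult; [apply continuous_fst|].
    apply continuous_Cminus; [exact Hs|apply continuous_const].
  - intros b Hb w Hw. apply continuous_Cmult.
    + apply (continuous_Ccomp f (fun w => seg a w b)).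
      * apply continuous_Cplus; [apply continuous_const|].
        apply continuous_Cmult; [apply continuous_const|].
        apply continuous_Cminus; [apply continuous_id|apply continuous_const].
      * eapply is_derive_continuous, f_derive, Hseg; assumption.
    + apply continuous_Cmult; [apply continuous_id|].
      apply continuous_Cinv; [|now apply (circle_minus_neq_0 r)].
      apply continuous_Cminus; [apply continuous_id|apply continuous_const].
Qed.

(* Shrinking the circle towards [a] does not change the mean. *)
Lemma cauchy_formula_C1 : cauchy_transform r (fun w => f w * w) 0 a = f a.
Proof.
  transitivity (dilation 1).
  { apply circle_mean_ext; [lra|]. intros w Hw. rewrite seg_1. simpl. field.
    now apply (circle_minus_neq_0 r). }
  transitivity (dilation 0).
  { apply is_derive_0_seg. intros t Ht. replace (seg 0 1 t) with (RtoC t) by (unfold seg; ring).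
    now apply is_derive_dilation. }
  transitivity (f a * cauchy_transform r (fun w => w) 0 a).
  - unfold dilation, cauchy_transform. rewrite <- circle_mean_scal; [|lra|].
    + apply circle_mean_ext; [lra|]. intros w Hw. rewrite seg_0. simpl. field.
      now apply (circle_minus_neq_0 r).
    + intros w Hw. apply continuous_Cmult; [apply continuous_id|].
      now apply (continuous_cauchy_kernel r).
  - rewrite circle_mean_winding; [ring|lra|exact a_lt_r].
Qed.

End CauchyFormula.

(* A primitive of [f] is given by Cauchy's formula, which can be differentiated three times. *)
Lemma analytic_C_derive (f : C -> C) : analytic_on_disk f -> analytic_on_disk (C_derive f).
Proof.
  intros Hf z Hz. set (P := segint f 0).
  assert (HP : forall w, in_disk w -> is_derive P w (f w)).
  { intros w Hw. apply is_derive_segint; auto using in_disk_0. }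
  set (r := ((1 + Cmod z) / 2)%R). unfold in_disk in Hz. pose proof (Cmod_ge_0 z) as Pz.
  assert (Hr : 0 < r < 1) by (unfold r; lra). assert (Hzr : Cmod z < r) by (unfold r; lra).
  assert (Hd : forall w, Cmod w < r -> in_disk w) by (intros w Hw; unfold in_disk; lra).
  set (T := cauchy_transform r (fun w => P w * w)).
  assert (HT : forall n w, Cmod w < r -> is_derive (T n) w (INR (S n) * T (S n) w)).
  { intros n w. apply is_derive_cauchy_transform; [apply Hr|].
    intros v Hv. apply continuous_Cmult; [|apply continuous_id].
    eapply is_derive_continuous, HP. unfold in_disk. lra. }
  assert (HP0 : forall w, Cmod w < r -> T O w = P w).
  { intros w Hw. apply (cauchy_formula_C1 P f); auto. now apply analytic_continuous. }
  assert (Hf1 : forall w, Cmod w < r -> 1 * T 1%nat w = f w).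
  { intros w Hw. apply (is_derive_unique_ext_disk (T O) P r w); auto. }
  assert (Hf2 : forall w, Cmod w < r -> 1 * (INR 2 * T 2%nat w) = C_derive f w).
  { intros w Hw. apply (is_derive_unique_ext_disk (fun w => 1 * T 1%nat w) f r w); auto.
    - now apply is_derive_Cscal, HT.
    - apply analytic_is_derive; auto. }
  eexists. apply (is_derive_ext_disk _ _ r z _ Hf2 Hzr), is_derive_Cscal, is_derive_Cscal, HT, Hzr.
Qed.

Lemma cauchy_formula (f : C -> C) (r : R) (a : C) :
  analytic_on_disk f -> 0 < r < 1 -> Cmod a < r ->
  circle_mean r (fun w => f w * (w * / (w - a))) = f a.
Proof.
  intros Hf Hr Ha. rewrite <- (cauchy_formula_C1 f (C_derive f) (fun z => analytic_is_derive f z Hf)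
    (analytic_continuous _ (analytic_C_derive f Hf)) r a Hr Ha).
  apply circle_mean_ext; [apply Hr|]. intros w Hw. simpl. ring.
Qed.

Lemma cauchy_estimate (f : C -> C) (r M : R) (a : C) :
  analytic_on_disk f -> 0 < r < 1 -> Cmod a < r ->
  (forall w, Cmod w = r -> Cmod (f w) <= M) -> Cmod (f a) <= M * (r / (r - Cmod a)).
Proof.
  intros Hf Hr Ha HM. rewrite <- (cauchy_formula f r a Hf Hr Ha).
  assert (Hcircle : forall w, Cmod w = r -> in_disk w) by (intros w Hw; unfold in_disk; lra).
  apply Cmod_circle_mean_le; [apply Hr|..]; intros w Hw;
    assert (Hwa := circle_minus_neq_0 r a w Ha Hw).
  - apply continuous_Cmult; [now apply analytic_continuous, Hcircle|].
    apply continuous_Cmult; [apply continuous_id|]. apply continuous_Cinv; [|exact Hwa].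
    apply continuous_Cminus; [apply continuous_id|apply continuous_const].
  - apply Cmod_mult_le; [now apply HM|]. rewrite Cmod_mult, Cmod_inv, Hw by exact Hwa.
    apply Rmult_le_compat_l; [lra|]. apply Rinv_le_contravar; [lra|].
    rewrite <- Hw at 1. apply Cmod_triangle_inv.
Qed.

(* The constant of the Cauchy estimate disappears when it is applied to the powers of [f]. *)
Lemma maximum_modulus (f : C -> C) (r M : R) (a : C) :
  analytic_on_disk f -> 0 < r < 1 -> Cmod a < r ->
  (forall w, Cmod w = r -> Cmod (f w) <= M) -> Cmod (f a) <= M.
Proof.
  intros Hf Hr Ha HM. apply Rnot_lt_le. intros Hlt.
  assert (PM : 0 <= M).
  { eapply Rle_trans; [apply Cmod_ge_0|]. apply (HM r). rewrite Cmod_R, Rabs_right; lra. }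
  set (x := Cmod (f a)) in *. set (K := (r / (r - Cmod a))%R).
  assert (Hq : 0 <= M / x < 1) by (split; [apply Rdiv_le_0_compat|apply Rlt_div_l]; lra).
  assert (Hpow : forall n, 1 <= K * (M / x) ^ n).
  { intros n. assert (Px : 0 < x ^ n) by (apply pow_lt; lra).
    pose proof (cauchy_estimate (fun z => f z ^ n) r (M ^ n) a (analytic_pow f n Hf) Hr Ha) as H.
    cbv beta in H. rewrite Cmod_pow in H. fold x K in H.
    unfold Rdiv. rewrite Rpow_mult_distr, pow_inv.
    replace (K * (M ^ n * / x ^ n))%R with (M ^ n * K / x ^ n)%R by (unfold Rdiv; ring).
    apply Rle_div_r; [exact Px|]. rewrite Rmult_1_l. apply H.
    intros w Hw. rewrite Cmod_pow. apply pow_incr. split; [apply Cmod_ge_0|now apply HM]. }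
  assert (Hlim : is_lim_seq (fun n => K * (M / x) ^ n)%R 0).
  { replace (Finite 0) with (Rbar_mult K 0) by (simpl; f_equal; ring).
    apply is_lim_seq_scal_l, is_lim_seq_geom. rewrite Rabs_right; lra. }
  pose proof (is_lim_seq_le _ _ _ _ Hpow (is_lim_seq_const 1) Hlim) as H. simpl in H. lra.
Qed.

(* The function of the usual statement is [w * phi w], so that no singularity is removed. *)
Lemma schwarz (phi : C -> C) (z : C) : analytic_on_disk phi ->
  (forall w, in_disk w -> Cmod (w * phi w) <= 1) -> in_disk z -> Cmod (phi z) <= 1.
Proof.
  intros Hphi H1 Hz. unfold in_disk in Hz. pose proof (Cmod_ge_0 z).
  assert (Hr : forall r, Cmod z < r < 1 -> r * Cmod (phi z) <= 1).
  { intros r Hzr. rewrite Rmult_comm. apply Rle_div_r; [lra|].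
    apply (maximum_modulus phi r); [exact Hphi|lra|lra|]. intros w Hw.
    apply Rle_div_r; [lra|]. rewrite Rmult_comm, <- Hw, <- Cmod_mult.
    apply H1. unfold in_disk. lra. }
  apply Rnot_lt_le. intros Hlt. set (x := Cmod (phi z)) in *.
  assert (Hx : / x < 1) by (rewrite <- Rinv_1; apply Rinv_lt_contravar; lra).
  assert (Hm : Rmax (Cmod z) (/ x) < 1) by now apply Rmax_lub_lt.
  pose proof (Rmax_l (Cmod z) (/ x)). pose proof (Rmax_r (Cmod z) (/ x)).
  specialize (Hr ((1 + Rmax (Cmod z) (/ x)) / 2)%R ltac:(lra)).
  assert (x * / x = 1)%R by (field; lra). nra.
Qed.

(* The Cayley transform [v / (v + 2)] maps the half-plane [Re v > -1] into the disk. *)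
Lemma schwarz_half_plane (phi : C -> C) (z : C) : analytic_on_disk phi ->
  (forall w, in_disk w -> -1 < Re (w * phi w)) -> in_disk z ->
  Cmod (phi z) <= Cmod (z * phi z + 2).
Proof.
  intros Hphi Hre Hz.
  assert (Hmod : forall w, in_disk w -> Cmod (w * phi w) <= Cmod (w * phi w + 2)).
  { intros w Hw. specialize (Hre w Hw).
    apply Rsqr_incr_0; [|apply Cmod_ge_0|apply Cmod_ge_0]. rewrite !Rsqr_pow2, !Cmod2_alt.
    destruct (w * phi w) as [x y]. simpl in *. nra. }
  assert (Hne : forall w, in_disk w -> w * phi w + 2 <> 0).
  { intros w Hw E. specialize (Hre w Hw).
    replace (w * phi w) with (- (2)) in Hre; [simpl in Hre; lra|].
    apply Cminus_eq_0. rewrite <- Copp_0, <- E. ring. }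
  assert (Pz : 0 < Cmod (z * phi z + 2)) by now apply Cmod_gt_0, Hne.
  assert (Hom : Cmod (phi z * / (z * phi z + 2)) <= 1).
  { apply (schwarz (fun w => phi w * / (w * phi w + 2))); [|..|exact Hz].
    - apply analytic_mult; [exact Hphi|]. intros w Hw. eexists.
      apply is_derive_Cinv_comp; [|now apply Hne].
      apply is_derive_Cplus; [|apply is_derive_Cconst].
      apply is_derive_Cmult; [apply is_derive_Cid|now apply analytic_is_derive].
    - intros w Hw. rewrite Cmult_assoc.
      change (Cmod (w * phi w / (w * phi w + 2)) <= 1). rewrite Cmod_div by now apply Hne.
      apply Rle_div_l; [now apply Cmod_gt_0, Hne|]. rewrite Rmult_1_l. now apply Hmod. }
  change (Cmod (phi z / (z * phi z + 2)) <= 1) in Hom. rewrite Cmod_div in Hom by now apply Hne.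
  apply Rle_div_l in Hom; [|exact Pz]. lra.
Qed.

(** * Loewner chains *)

Lemma unit_interval_induction (P : R -> Prop) : P 0%R ->
  (forall s, 0 <= s <= 1 -> P s ->
     exists d, 0 < d /\ forall s', 0 <= s' <= 1 -> Rabs (s' - s) < d -> P s') ->
  (forall s, 0 < s <= 1 -> (forall s', 0 <= s' < s -> P s') -> P s) ->
  forall s, 0 <= s <= 1 -> P s.
Proof.
  intros H0 Hopen Hleft.
  set (Q := fun x => 0 <= x <= 1 /\ forall s, 0 <= s <= x -> P s).
  assert (HQ0 : Q 0%R).
  { split; [lra|]. intros s Hs. replace s with 0%R by lra. exact H0. }
  destruct (completeness Q) as [m [Hub Hlub]].
  { exists 1%R. intros x [Hx _]. lra. }
  { now exists 0%R. }
  assert (Hm0 : 0 <= m) by now apply Hub.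
  assert (Hm1 : m <= 1) by (apply Hlub; intros x [Hx _]; lra).
  assert (Hbelow : forall s, 0 <= s < m -> P s).
  { intros s Hs. apply NNPP. intros Hn. apply (Rlt_not_le m s (proj2 Hs)), Hlub.
    intros x [Hx HP]. apply Rnot_lt_le. intros Hsx. apply Hn, HP. lra. }
  assert (Hm : P m).
  { destruct (Rle_lt_or_eq_dec _ _ Hm0) as [Hpos|<-]; [apply Hleft; [lra|exact Hbelow]|exact H0]. }
  destruct (Hopen m (conj Hm0 Hm1) Hm) as (d & Hd & Hnear).
  assert (HQ : Q (Rmin 1 (m + d / 2))).
  { pose proof (Rmin_l 1 (m + d / 2)). pose proof (Rmin_r 1 (m + d / 2)).
    split; [split; [apply Rmin_glb; lra|assumption]|]. intros s Hs.
    destruct (Rlt_le_dec s m) as [Hsm|Hsm]; [apply Hbelow; lra|].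
    apply Hnear; [lra|]. rewrite Rabs_right; lra. }
  destruct HQ as [HQ1 HQ2]. intros s Hs. apply HQ2. split; [lra|].
  apply Rmin_glb; [lra|]. assert (Hmax : Rmin 1 (m + d / 2) <= m) by (now apply Hub; split).
  unfold Rmin in Hmax. destruct (Rle_dec 1 (m + d / 2)); lra.
Qed.

Lemma contraction_fixpoint (N : C -> C) (z : C) (rho : R) :
  (forall x y, Cmod (x - z) <= rho -> Cmod (y - z) <= rho ->
     Cmod (N x - N y) <= / 2 * Cmod (x - y)) ->
  4 * Cmod (N z - z) <= rho ->
  exists l, Cmod (l - z) <= 4 * Cmod (N z - z) /\ N l = l.
Proof.
  intros HN Hrho. set (e := Cmod (N z - z)) in *. assert (Pe : 0 <= e) by apply Cmod_ge_0.
  set (x := fun n => Nat.iter n N z).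
  assert (Hx : forall n, Cmod (x n - z) <= 2 * e * (1 - (/ 2) ^ n) /\
     Cmod (x (S n) - x n) <= e * (/ 2) ^ n).
  { induction n as [|n [IH1 IH2]].
    - simpl. rewrite Cmod_minus_self. fold e. lra.
    - assert (P : 0 < (/ 2) ^ n) by (apply pow_lt; lra).
      assert (HS : Cmod (x (S n) - z) <= 2 * e * (1 - (/ 2) ^ S n)).
      { pose proof (Cmod_minus_triangle (x (S n)) (x n) z). simpl pow. lra. }
      split; [exact HS|]. simpl pow in *.
      eapply Rle_trans; [apply (HN (x (S n)) (x n)); nra|]. lra. }
  destruct (C_geometric_limit x e (fun n => proj2 (Hx n))) as [l Hl].
  assert (Hlz : Cmod (l - z) <= 4 * e).
  { specialize (Hl O). rewrite Cmod_minus_sym in Hl. simpl in Hl. lra. }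
  exists l. split; [exact Hlz|]. apply Cmod_minus_le_0, Rnot_lt_le. intros Hp.
  destruct (half_pow_lt (8 * e) _ Hp) as [n Hn].
  assert (P : 0 < (/ 2) ^ n) by (apply pow_lt; lra).
  assert (Hnl : Cmod (N l - x (S n)) <= / 2 * Cmod (l - x n)).
  { apply (HN l (x n)); [lra|]. destruct (Hx n) as [H1 _]. nra. }
  rewrite (Cmod_minus_sym l) in Hnl.
  pose proof (Hl n) as Hln. pose proof (Hl (S n)) as HlS. simpl pow in HlS.
  pose proof (Cmod_minus_triangle (N l) (x (S n)) l). nra.
Qed.

(* Newton's method with the fixed slope [L]. *)
Lemma local_preimage (G : C -> C) (z v L : C) (rho e : R) :
  L <> 0 -> 0 <= e <= / 2 -> 4 * Cmod v <= rho ->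
  (forall x y, Cmod (x - z) <= rho -> Cmod (y - z) <= rho ->
     Cmod (G x - G y - L * (x - y)) <= e * Cmod L * Cmod (x - y)) ->
  exists l, G l = G z + L * v /\ Cmod (l - z) <= 4 * Cmod v /\ Cmod (l - (z + v)) <= 4 * e * Cmod v.
Proof.
  intros HL He Hv HG. set (N := fun x => x - (G x - G z - L * v) / L).
  assert (PL : 0 < Cmod L) by now apply Cmod_gt_0.
  assert (HNz : N z = z + v) by (unfold N; field; exact HL).
  assert (Hvz : N z - z = v) by (rewrite HNz; ring).
  assert (HN : forall x y, Cmod (x - z) <= rho -> Cmod (y - z) <= rho ->
    Cmod (N x - N y) <= e * Cmod (x - y)).
  { intros x y Hx Hy.
    replace (N x - N y) with (- ((G x - G y - L * (x - y)) / L)) by (unfold N; field; exact HL).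
    rewrite Cmod_opp, Cmod_div by exact HL. apply Rle_div_l; [exact PL|].
    specialize (HG x y Hx Hy). lra. }
  destruct (contraction_fixpoint N z rho) as (l & Hlz & Hl).
  - intros x y Hx Hy. pose proof (Cmod_ge_0 (x - y)). specialize (HN x y Hx Hy). nra.
  - rewrite Hvz. exact Hv.
  - rewrite Hvz in Hlz. exists l. split; [|split; [exact Hlz|]].
    + assert (Hres : (G l - G z - L * v) / L = 0).
      { replace ((G l - G z - L * v) / L) with (l - N l) by (unfold N; ring). rewrite Hl. ring. }
      apply Cminus_eq_0.
      replace (G l - (G z + L * v)) with ((G l - G z - L * v) / L * L) by (field; exact HL).
      rewrite Hres. ring.
    + rewrite <- HNz, <- Hl at 1. pose proof (Cmod_ge_0 v).
      eapply Rle_trans; [apply HN|].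
      * lra.
      * rewrite Cmod_minus_self. lra.
      * rewrite (Rmult_comm 4), Rmult_assoc. apply Rmult_le_compat_l; lra.
Qed.

Lemma is_derive_strict (f f1 : C -> C) (z : C) (e : R) :
  (forall w, in_disk w -> is_derive f w (f1 w)) -> continuous_on_disk f1 -> in_disk z -> 0 < e ->
  exists d, 0 < d /\ forall x y, Cmod (x - z) < d -> Cmod (y - z) < d ->
    Cmod (f x - f y - f1 z * (x - y)) <= e * Cmod (x - y).
Proof.
  intros Hf Hf1 Hz He.
  destruct (proj1 (continuous_Cmod f1 z) (Hf1 z Hz) e He) as (d & Hd & Hnear).
  exists (Rmin d (1 - Cmod z)). unfold in_disk in Hz. split; [apply Rmin_glb_lt; lra|].
  intros x y Hx Hy. apply Rmin_Rgt_l in Hx as [Hx1 Hx2], Hy as [Hy1 Hy2].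
  assert (Hdisk : forall w, Cmod (w - z) < 1 - Cmod z -> in_disk w).
  { intros w Hw. pose proof (Cmod_triangle_inv w z). unfold in_disk. lra. }
  apply (Cmod_increment_le f f1).
  - intros t Ht. now apply Hf, in_disk_seg; [|apply Hdisk|apply Hdisk].
  - apply continuous_on_disk_seg; [exact Hf1|now apply Hdisk|now apply Hdisk].
  - intros t Ht. left. apply Hnear. rewrite seg_minus. now apply Cmod_seg_lt.
Qed.

Lemma Re_div_gt_half (E L : C) : L <> 0 -> Cmod (L - E) < Cmod E -> / 2 < Re (E / L).
Proof.
  intros HL H. assert (PL : 0 < Cmod L ^ 2) by (apply pow_lt; now apply Cmod_gt_0).
  assert (Hsq : Cmod (L - E) ^ 2 < Cmod E ^ 2).
  { pose proof (Cmod_ge_0 (L - E)). nra. }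
  rewrite !Cmod2_alt in *. destruct E as [p q], L as [x y]. simpl in *.
  replace (p * (x / (x * (x * 1) + y * (y * 1))) - q * (- y / (x * (x * 1) + y * (y * 1))))%R
    with ((p * x + q * y) / (x * (x * 1) + y * (y * 1)))%R by (field; lra).
  apply Rlt_div_r; lra.
Qed.

Lemma Cmod_sqr_contraction (Y : C) : / 2 < Re Y ->
  exists k d, 0 < k /\ 0 < d /\ forall (e : R) (z l : C), 0 < e < d ->
    Cmod (l - (z - e * Y * z)) <= k * Cmod (e * Y * z) -> Cmod l ^ 2 <= (1 - e) * Cmod z ^ 2.
Proof.
  intros HY. set (m := ((Re Y - / 2) / 2)%R). assert (Pm : 0 < m) by (unfold m; lra).
  assert (PY : 0 < Cmod Y).
  { pose proof (re_le_Cmod Y). pose proof (Rle_abs (Re Y)). lra. }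
  set (K := (Cmod Y + m)%R). assert (PK : 0 < K ^ 2) by (apply pow_lt; unfold K; lra).
  exists (m / Cmod Y)%R, (2 * m / K ^ 2)%R. split; [|split]; [apply Rdiv_lt_0_compat; lra..|].
  intros e z l He Hl. assert (HeK : e * K ^ 2 <= 2 * m) by (left; apply Rlt_div_r; tauto).
  rewrite !Cmod_mult, Cmod_R, Rabs_right in Hl by lra.
  replace (m / Cmod Y * (e * Cmod Y * Cmod z))%R with (m * (e * Cmod z))%R in Hl by (field; lra).
  destruct (Ceq_dec z 0) as [->|Hz].
  { assert (l = 0) as ->; [|rewrite Cmod_0; simpl; lra].
    apply Cmod_minus_le_0. rewrite Cmod_0, !Rmult_0_r in Hl.
    now replace (l - (0 - e * Y * 0)) with (l - 0) in Hl by ring. }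
  assert (Pez : 0 < e * Cmod z) by (apply Rmult_lt_0_compat; [lra|now apply Cmod_gt_0]).
  assert (Ne : RtoC e <> 0) by (apply RtoC_neq_0; lra).
  set (u := (z - l) / (e * z)).
  assert (Hu : Cmod (u - Y) <= m).
  { replace (u - Y) with (- (l - (z - e * Y * z)) / (e * z)) by (unfold u; field; auto).
    rewrite Cmod_div, Cmod_opp, Cmod_mult, Cmod_R, Rabs_right by (lra || now apply Cmult_neq_0).
    now apply Rle_div_l. }
  assert (HuK : Cmod u ^ 2 <= K ^ 2).
  { apply pow_incr. pose proof (Cmod_triangle_inv u Y). pose proof (Cmod_ge_0 u). unfold K. lra. }
  assert (Hre : Re Y - m <= Re u).
  { pose proof (Rle_trans _ _ _ (re_le_Cmod (u - Y)) Hu) as H.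
    destruct u, Y. simpl in *. apply Rabs_le_between in H. lra. }
  replace l with (z * (1 - e * u)) by (unfold u; field; auto).
  rewrite Cmod_mult, Rpow_mult_distr, Rmult_comm. apply Rmult_le_compat_r; [apply pow2_ge_0|].
  replace (Cmod (1 - e * u) ^ 2)%R with (1 - 2 * e * Re u + e * (e * Cmod u ^ 2))%R.
  - assert (e * Cmod u ^ 2 <= e * K ^ 2) by (apply Rmult_le_compat_l; lra).
    unfold m in *. nra.
  - rewrite !Cmod2_alt. destruct u as [p q]. simpl. ring.
Qed.

Section LoewnerChain.
Variables (A A1 B B1 E : C -> C) (r : R).
Hypothesis A_derive : forall z, in_disk z -> is_derive A z (A1 z).
Hypothesis B_derive : forall z, in_disk z -> is_derive B z (B1 z).
Hypothesis A1_cont : continuous_on_disk A1.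
Hypothesis B1_cont : continuous_on_disk B1.
Hypothesis B_factor : forall z, in_disk z -> B z = E z * z.
Hypothesis r_bounds : 0 < r < 1.

Definition chain (s : R) (z : C) : C := s * A z + (1 - s) * B z.
Definition chain_derive (s : R) (z : C) : C := s * A1 z + (1 - s) * B1 z.
Definition chain_domain (s : R) (z : C) : Prop := Cmod z ^ 2 <= s * r ^ 2.

Hypothesis chain_derive_near : forall s z, 0 <= s <= 1 -> chain_domain s z ->
  Cmod (chain_derive s z - E z) < Cmod (E z).

Lemma chain_domain_le (s : R) (z : C) : s <= 1 -> chain_domain s z -> Cmod z <= r.
Proof.
  unfold chain_domain. intros Hs Hz. apply Rsqr_incr_0; [|apply Cmod_ge_0|lra].
  rewrite !Rsqr_pow2. assert (0 < r ^ 2) by (apply pow_lt; lra). nra.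
Qed.

Lemma chain_domain_in_disk (s : R) (z : C) : s <= 1 -> chain_domain s z -> in_disk z.
Proof. intros Hs Hz. apply Rle_lt_trans with r; [now apply chain_domain_le with s|lra]. Qed.

Lemma chain_derive_neq_0 (s : R) (z : C) : 0 <= s <= 1 -> chain_domain s z -> chain_derive s z <> 0.
Proof.
  intros Hs Hz H0. pose proof (chain_derive_near s z Hs Hz) as H. rewrite H0 in H.
  replace (0 - E z) with (- E z) in H by ring. rewrite Cmod_opp in H. lra.
Qed.

Lemma Cmod_convex_comb_le (s e : R) (x y : C) : 0 <= s <= 1 -> Cmod x <= e -> Cmod y <= e ->
  Cmod (s * x + (1 - s) * y) <= e.
Proof.
  intros Hs Hx Hy. replace (s * x + (1 - s) * y) with (seg y x s) by (unfold seg; ring).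
  now apply Cmod_seg_le.
Qed.

Lemma chain_strict_derivative (s : R) (z : C) (e : R) : in_disk z -> 0 < e ->
  exists d, 0 < d /\ forall s' x y, 0 <= s' <= 1 -> Rabs (s' - s) < d ->
    Cmod (x - z) < d -> Cmod (y - z) < d ->
    Cmod (chain s' x - chain s' y - chain_derive s z * (x - y)) <= e * Cmod (x - y).
Proof.
  intros Hz He.
  destruct (is_derive_strict A A1 z (e / 2) A_derive A1_cont Hz) as (dA & HdA & HA); [lra|].
  destruct (is_derive_strict B B1 z (e / 2) B_derive B1_cont Hz) as (dB & HdB & HB); [lra|].
  pose proof (Cmod_ge_0 (A1 z - B1 z)) as PD. set (D := Cmod (A1 z - B1 z)) in *.
  assert (Pd : 0 < e / 2 / (D + 1)) by (apply Rdiv_lt_0_compat; lra).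
  exists (Rmin (Rmin dA dB) (e / 2 / (D + 1))). split; [repeat apply Rmin_glb_lt; assumption|].
  intros s' x y Hs' Hss Hx Hy.
  apply Rmin_Rgt_l in Hss as [_ Hss], Hx as [Hx _], Hy as [Hy _].
  apply Rmin_Rgt_l in Hx as [HxA HxB], Hy as [HyA HyB].
  replace (chain s' x - chain s' y - chain_derive s z * (x - y)) with
    ((s' * (A x - A y - A1 z * (x - y)) + (1 - s') * (B x - B y - B1 z * (x - y))) +
     RtoC (s' - s) * (A1 z - B1 z) * (x - y))
    by (unfold chain, chain_derive; rewrite RtoC_minus; ring).
  eapply Rle_trans; [apply Cmod_triangle|]. replace e with (e / 2 + e / 2)%R by field.
  rewrite Rmult_plus_distr_r. apply Rplus_le_compat.
  - apply Cmod_convex_comb_le; auto.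
  - apply Cmod_mult_le; [|apply Rle_refl]. rewrite Cmod_mult, Cmod_R. fold D.
    apply Rlt_div_r in Hss; [|lra]. pose proof (Rabs_pos (s' - s)). nra.
Qed.

Lemma chain_jointly_continuous (s : R) (z : C) (e : R) : in_disk z -> 0 < e ->
  exists d, 0 < d /\ forall s' x, 0 <= s' <= 1 -> Rabs (s' - s) < d -> Cmod (x - z) < d ->
    Cmod (chain s' x - chain s z) < e.
Proof.
  intros Hz He. assert (He2 : 0 < e / 2) by lra.
  destruct (proj1 (continuous_Cmod A z) (is_derive_continuous _ _ _ (A_derive z Hz)) _ He2)
    as (dA & HdA & HA).
  destruct (proj1 (continuous_Cmod B z) (is_derive_continuous _ _ _ (B_derive z Hz)) _ He2)
    as (dB & HdB & HB).
  pose proof (Cmod_ge_0 (A z - B z)) as PD. set (D := Cmod (A z - B z)) in *.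
  assert (Pd : 0 < e / 2 / (D + 1)) by (apply Rdiv_lt_0_compat; lra).
  exists (Rmin (Rmin dA dB) (e / 2 / (D + 1))). split; [repeat apply Rmin_glb_lt; assumption|].
  intros s' x Hs' Hss Hx. apply Rmin_Rgt_l in Hss as [_ Hss], Hx as [Hx _].
  apply Rmin_Rgt_l in Hx as [HxA HxB].
  replace (chain s' x - chain s z) with
    ((s' * (A x - A z) + (1 - s') * (B x - B z)) + RtoC (s' - s) * (A z - B z))
    by (unfold chain; rewrite RtoC_minus; ring).
  eapply Rle_lt_trans; [apply Cmod_triangle|]. replace e with (e / 2 + e / 2)%R by field.
  apply Rplus_le_lt_compat.
  - apply Cmod_convex_comb_le; [exact Hs'|left; auto|left; auto].
  - rewrite Cmod_mult, Cmod_R. fold D. apply Rlt_div_r in Hss; [|lra].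
    pose proof (Rabs_pos (s' - s)). nra.
Qed.

Lemma chain_domain_closed (s : R) (z : C) : Cmod z <= r -> ~ chain_domain s z ->
  exists d, 0 < d /\ forall s' x, Rabs (s' - s) < d -> Cmod (x - z) < d -> ~ chain_domain s' x.
Proof.
  unfold chain_domain. intros Hz Hn. apply Rnot_le_lt in Hn.
  set (g := (Cmod z ^ 2 - s * r ^ 2)%R). assert (Pg : 0 < g) by (unfold g; lra).
  exists (g / 3)%R. split; [lra|]. intros s' x Hs' Hx H.
  pose proof (Cmod_triangle_inv z x) as Htri. rewrite Cmod_minus_sym in Htri.
  pose proof (Cmod_ge_0 z). pose proof (Cmod_ge_0 x). apply Rabs_def2 in Hs'.
  assert (Hr2 : 0 < r ^ 2 < 1) by nra.
  assert (Hs2 : s' * r ^ 2 < s * r ^ 2 + g / 3) by nra.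
  assert (Hz2 : Cmod z ^ 2 <= Cmod x ^ 2 + 2 * (g / 3)).
  { assert (Hdiff : Cmod z - Cmod x <= g / 3) by lra.
    destruct (Rle_lt_dec (Cmod z) (Cmod x)); nra. }
  unfold g in *. lra.
Qed.

Definition chain_collision (s : R) (z w : C) : Prop :=
  z <> w /\ chain_domain s z /\ chain_domain s w /\ chain s z = chain s w.

Lemma chain_no_collision_near (s : R) (z w : C) : 0 <= s <= 1 -> Cmod z <= r -> Cmod w <= r ->
  ~ chain_collision s z w ->
  exists d, 0 < d /\ forall s' x y, 0 <= s' <= 1 -> Rabs (s' - s) < d ->
    Cmod (x - z) < d -> Cmod (y - w) < d -> ~ chain_collision s' x y.
Proof.
  intros Hs Hz Hw Hn.
  assert (Hzd : in_disk z) by (unfold in_disk; lra).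
  assert (Hwd : in_disk w) by (unfold in_disk; lra).
  destruct (classic (chain_domain s z)) as [Dz|Dz].
  2: { destruct (chain_domain_closed s z Hz Dz) as (d & Hd & Hout). exists d. split; [exact Hd|].
       intros s' x y _ Hs' Hx _ (_ & Dx & _). exact (Hout s' x Hs' Hx Dx). }
  destruct (classic (chain_domain s w)) as [Dw|Dw].
  2: { destruct (chain_domain_closed s w Hw Dw) as (d & Hd & Hout). exists d. split; [exact Hd|].
       intros s' x y _ Hs' _ Hy (_ & _ & Dy & _). exact (Hout s' y Hs' Hy Dy). }
  destruct (Ceq_dec z w) as [<-|Hne].
  - assert (PL := proj1 (Cmod_gt_0 _) (chain_derive_neq_0 s z Hs Dz)).
    destruct (chain_strict_derivative s z (Cmod (chain_derive s z) / 2) Hzd) as (d & Hd & Hstrict);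
      [lra|].
    exists d. split; [exact Hd|]. intros s' x y Hs' Hss Hx Hy (Hxy & _ & _ & Heq).
    specialize (Hstrict s' x y Hs' Hss Hx Hy). rewrite Heq in Hstrict.
    replace (chain s' y - chain s' y - chain_derive s z * (x - y)) with
      (- (chain_derive s z * (x - y))) in Hstrict by ring.
    rewrite Cmod_opp, Cmod_mult in Hstrict. pose proof (Cmod_minus_gt_0 x y Hxy). nra.
  - assert (Hgap : 0 < Cmod (chain s z - chain s w)).
    { apply Cmod_minus_gt_0. intros Heq. now apply Hn. }
    set (g := Cmod (chain s z - chain s w)) in *. assert (Hg2 : 0 < g / 2) by lra.
    destruct (chain_jointly_continuous s z (g / 2) Hzd Hg2) as (dz & Hdz & Hcz).
    destruct (chain_jointly_continuous s w (g / 2) Hwd Hg2) as (dw & Hdw & Hcw).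
    exists (Rmin dz dw). split; [now apply Rmin_glb_lt|].
    intros s' x y Hs' Hss Hx Hy (_ & _ & _ & Heq).
    apply Rmin_Rgt_l in Hss as [Hsz Hsw], Hx as [Hx _], Hy as [_ Hy].
    specialize (Hcz s' x Hs' Hsz Hx). specialize (Hcw s' y Hs' Hsw Hy). rewrite Heq in Hcz.
    pose proof (Cmod_minus_triangle (chain s z) (chain s' y) (chain s w)) as Htri.
    rewrite (Cmod_minus_sym (chain s z) (chain s' y)) in Htri. fold g in Htri. lra.
Qed.

Lemma chain_no_collision_open (s : R) : 0 <= s <= 1 -> (forall z w, ~ chain_collision s z w) ->
  exists d, 0 < d /\ forall s', 0 <= s' <= 1 -> Rabs (s' - s) < d ->
    forall z w, ~ chain_collision s' z w.
Proof.
  intros Hs Hn.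
  destruct (closed_disk_uniform_radius r (fun d z => forall s' y, 0 <= s' <= 1 ->
    Rabs (s' - s) < d -> Cmod y <= r -> ~ chain_collision s' z y)) as (d & Hd & Hunif).
  - intros d d' z Hd H s' y Hs' Hss. apply H; [exact Hs'|lra].
  - intros z Hz.
    destruct (closed_disk_uniform_radius r (fun d y => forall s' x, 0 <= s' <= 1 ->
      Rabs (s' - s) < d -> Cmod (x - z) < d -> ~ chain_collision s' x y)) as (d & Hd & Hunif).
    + intros d d' y Hd H s' x Hs' Hss Hx. apply H; [exact Hs'|lra|lra].
    + intros w Hw. destruct (chain_no_collision_near s z w Hs Hz Hw (Hn z w)) as (d & Hd & Hnear).
      exists d. split; [exact Hd|]. intros y _ Hy s' x Hs' Hss Hx. now apply Hnear.
    + exists d. split; [exact Hd|]. intros x _ Hx s' y Hs' Hss Hy. now apply Hunif.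
  - exists d. split; [exact Hd|]. intros s' Hs' Hss z w Hcol.
    destruct Hcol as (Hne & Dz & Dw & Heq).
    apply (Hunif z (chain_domain_le s' z (proj2 Hs') Dz) s' w Hs' Hss
      (chain_domain_le s' w (proj2 Hs') Dw)). now split.
Qed.

Lemma chain_local_preimage (s : R) (z : C) (q e : R) : 0 <= s <= 1 -> chain_domain s z ->
  0 < q <= / 2 -> 0 < e ->
  exists d, 0 < d /\ forall s' v, 0 <= s' <= 1 -> Rabs (s' - s) < d -> Cmod v < d ->
    exists l, chain s' l = chain s' z + chain_derive s z * v /\
      Cmod (l - z) < e /\ Cmod (l - (z + v)) <= 4 * q * Cmod v.
Proof.
  intros Hs Dz Hq He. set (L := chain_derive s z).
  assert (NL : L <> 0) by now apply chain_derive_neq_0. assert (PL := proj1 (Cmod_gt_0 L) NL).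
  destruct (chain_strict_derivative s z (q * Cmod L)) as (d & Hd & Hstrict).
  { exact (chain_domain_in_disk s z (proj2 Hs) Dz). }
  { nra. }
  pose proof (Rmin_l e d). pose proof (Rmin_r e d).
  assert (Hed : 0 < Rmin e d) by now apply Rmin_glb_lt.
  exists (Rmin e d / 8)%R. split; [lra|]. intros s' v Hs' Hss Hv.
  destruct (local_preimage (chain s') z v L (Rmin e d / 2) q NL) as (l & Hl & Hlz & Hlv).
  - lra.
  - lra.
  - intros x y Hx Hy. apply Hstrict; lra || assumption.
  - exists l. split; [exact Hl|]. split; [lra|exact Hlv].
Qed.

Lemma chain_scaled (s eps : R) (z : C) :
  chain ((1 - eps) * s) z - eps * B z = RtoC (1 - eps) * chain s z.
Proof. unfold chain. rewrite RtoC_mult, !RtoC_minus. ring. Qed.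

(* To first order [l = z - eps * (E z / chain_derive s z) * z]. *)
Lemma chain_level_step (s : R) (z : C) (e : R) : 0 < s <= 1 -> chain_domain s z -> 0 < e ->
  exists d, 0 < d /\ forall eps, 0 < eps < d -> eps <= 1 ->
    exists l, chain_domain ((1 - eps) * s) l /\ Cmod (l - z) < e /\
      chain ((1 - eps) * s) l = RtoC (1 - eps) * chain s z.
Proof.
  intros Hs Dz He. assert (Hs01 : 0 <= s <= 1) by lra.
  assert (Hzd := chain_domain_in_disk s z (proj2 Hs) Dz).
  set (L := chain_derive s z). assert (NL : L <> 0) by now apply chain_derive_neq_0.
  set (Y := E z / L). pose proof (Cmod_ge_0 Y).
  destruct (Cmod_sqr_contraction Y) as (k & d1 & Hk & Hd1 & Hcontr).
  { apply Re_div_gt_half; [exact NL|now apply chain_derive_near]. }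
  pose proof (Rmin_l (/ 2) (k / 4)). pose proof (Rmin_r (/ 2) (k / 4)).
  assert (Hq : 0 < Rmin (/ 2) (k / 4)) by (apply Rmin_glb_lt; lra).
  destruct (chain_local_preimage s z (Rmin (/ 2) (k / 4)) e Hs01 Dz) as (d2 & Hd2 & Hpre);
    [lra|exact He|].
  assert (Hd3 : 0 < d2 / (Cmod Y + 1)) by (apply Rdiv_lt_0_compat; lra).
  exists (Rmin d2 (Rmin d1 (d2 / (Cmod Y + 1)))). split; [now repeat apply Rmin_glb_lt|].
  intros eps [Peps Heps] Heps1. apply Rmin_Rgt_l in Heps as [Heps2 Heps].
  apply Rmin_Rgt_l in Heps as [Hepsd1 Hepsd3]. apply Rlt_div_r in Hepsd3; [|lra].
  set (w := eps * Y * z).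
  destruct (Hpre ((1 - eps) * s)%R (- w)) as (l & Hl & Hlz & Hlw).
  - nra.
  - rewrite Rabs_left; nra.
  - unfold w. rewrite Cmod_opp, !Cmod_mult, Cmod_R, Rabs_right by lra. unfold in_disk in Hzd.
    pose proof (Cmod_ge_0 z). nra.
  - exists l. split; [|split; [exact Hlz|]].
    + unfold chain_domain in *. apply Rle_trans with ((1 - eps) * Cmod z ^ 2)%R.
      * apply Hcontr; [lra|]. eapply Rle_trans; [exact Hlw|]. rewrite Cmod_opp.
        apply Rmult_le_compat_r; [apply Cmod_ge_0|lra].
      * rewrite Rmult_assoc. apply Rmult_le_compat_l; [lra|exact Dz].
    + rewrite Hl, <- chain_scaled, B_factor by exact Hzd. fold L. unfold w, Y. field. exact NL.
Qed.

Lemma chain_collision_backwards (s : R) (z w : C) : 0 < s <= 1 -> chain_collision s z w ->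
  exists s', 0 <= s' < s /\ exists x y, chain_collision s' x y.
Proof.
  intros Hs (Hne & Dz & Dw & Heq). assert (Hgap := Cmod_minus_gt_0 z w Hne).
  destruct (chain_level_step s z (Cmod (z - w) / 2) Hs Dz) as (dz & Hdz & Hz); [lra|].
  destruct (chain_level_step s w (Cmod (z - w) / 2) Hs Dw) as (dw & Hdw & Hw); [lra|].
  set (eps := (Rmin 1 (Rmin dz dw) / 2)%R).
  assert (Peps : 0 < eps) by (apply Rdiv_lt_0_compat; [repeat apply Rmin_glb_lt|]; lra).
  pose proof (Rmin_l 1 (Rmin dz dw)). pose proof (Rmin_r 1 (Rmin dz dw)).
  pose proof (Rmin_l dz dw). pose proof (Rmin_r dz dw).
  destruct (Hz eps) as (x & Dx & Hxz & Hx); [unfold eps in *; lra|unfold eps; lra|].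
  destruct (Hw eps) as (y & Dy & Hyw & Hy); [unfold eps in *; lra|unfold eps; lra|].
  exists ((1 - eps) * s)%R. split; [unfold eps in *; nra|].
  exists x, y. repeat split; [|exact Dx|exact Dy|now rewrite Hx, Hy, Heq].
  intros <-. pose proof (Cmod_minus_triangle z x w) as Htri.
  rewrite (Cmod_minus_sym z x) in Htri. lra.
Qed.

(* At [s = 0] the domain is a single point. *)
Lemma chain_no_collision (s : R) : 0 <= s <= 1 -> forall z w, ~ chain_collision s z w.
Proof.
  apply (unit_interval_induction (fun s => forall z w, ~ chain_collision s z w)).
  - intros z w (Hne & Dz & Dw & _). unfold chain_domain in Dz, Dw. rewrite Rmult_0_l in Dz, Dw.
    assert (H0 : forall x, Cmod x ^ 2 <= 0 -> x = 0).
    { intros x Hx. apply Cmod_eq_0, Rle_antisym; [|apply Cmod_ge_0]. apply Rnot_lt_le. nra. }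
    apply Hne. now rewrite (H0 z Dz), (H0 w Dw).
  - exact chain_no_collision_open.
  - intros s' Hs' Hbelow z w Hcol.
    destruct (chain_collision_backwards s' z w Hs' Hcol) as (t & Ht & x & y & Hxy).
    exact (Hbelow t Ht x y Hxy).
Qed.

Lemma loewner_injective (z w : C) : Cmod z <= r -> Cmod w <= r -> A z = A w -> z = w.
Proof.
  intros Hz Hw Heq. apply NNPP. intros Hne.
  assert (Hdom : forall x, Cmod x <= r -> chain_domain 1 x).
  { intros x Hx. unfold chain_domain. rewrite Rmult_1_l. apply pow_incr.
    split; [apply Cmod_ge_0|exact Hx]. }
  apply (chain_no_collision 1 ltac:(lra) z w). repeat split; auto.
  unfold chain. rewrite Heq. ring.
Qed.

End LoewnerChain.

Lemma ahlfors_convex_bound (c Q : C) (r s x : R) : 0 < r < 1 -> 0 < s <= 1 -> 0 <= x <= s * r ^ 2 ->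
  Cmod c <= 1 -> Cmod (RtoC (1 - x) * Q + c * x) <= 1 ->
  Cmod (s * (r ^ 2)%R * c + (1 - s) * Q) < 1.
Proof.
  intros Hr Hs Hx Hc HQ. assert (Hr2 : 0 < r ^ 2 < 1) by nra. assert (Hxs : x <= s) by nra.
  assert (Hx1 : x < 1) by nra. set (b := RtoC (1 - x) * Q + c * x) in *.
  assert (Hp : 0 <= s * r ^ 2 - (1 - s) * x / (1 - x)).
  { assert ((1 - s) * x / (1 - x) <= s * r ^ 2); [|lra].
    apply Rle_div_l; [lra|]. apply Rle_trans with (x * (1 - x))%R; nra. }
  replace (s * (r ^ 2)%R * c + (1 - s) * Q) with
    (RtoC (s * r ^ 2 - (1 - s) * x / (1 - x)) * c + RtoC ((1 - s) / (1 - x)) * b).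
  - eapply Rle_lt_trans; [apply Cmod_triangle|].
    apply Rle_lt_trans with ((s * r ^ 2 - (1 - s) * x / (1 - x)) * 1 + (1 - s) / (1 - x) * 1)%R.
    + apply Rplus_le_compat; apply Cmod_mult_le; try assumption; rewrite Cmod_R, Rabs_right;
        try lra. apply Rle_ge, Rdiv_le_0_compat; lra.
    + replace ((s * r ^ 2 - (1 - s) * x / (1 - x)) * 1 + (1 - s) / (1 - x) * 1)%R with
        (s * r ^ 2 + (1 - s))%R by (field; lra). nra.
  - assert (N : 1 - RtoC x <> 0) by (rewrite <- RtoC_minus; apply RtoC_neq_0; lra).
    unfold b, Rdiv. rewrite !RtoC_minus, !RtoC_mult, !RtoC_inv, !RtoC_minus by lra. field. exact N.
Qed.

Lemma ahlfors_univalence (F : C -> C) (c : C) : analytic_on_disk F -> Cmod c <= 1 ->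
  (forall z, in_disk z -> C_derive F z <> 0) ->
  (forall z, in_disk z ->
     Cmod (RtoC (1 - Cmod z ^ 2) * (z * C_derive (C_derive F) z / C_derive F z) +
           c * RtoC (Cmod z ^ 2)) <= 1) ->
  forall z w, in_disk z -> in_disk w -> F z = F w -> z = w.
Proof.
  intros HF Hc Hne Hcrit z w Hz Hw Heq. set (r := ((1 + Rmax (Cmod z) (Cmod w)) / 2)%R).
  pose proof (Rmax_l (Cmod z) (Cmod w)). pose proof (Rmax_r (Cmod z) (Cmod w)).
  assert (Rmax (Cmod z) (Cmod w) < 1) by now apply Rmax_lub_lt. pose proof (Cmod_ge_0 z).
  assert (Hr : 0 < r < 1) by (unfold r; lra).
  assert (HF1 := analytic_C_derive F HF). assert (HF2 := analytic_C_derive _ HF1).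
  set (E := C_derive F) in *. set (E1 := C_derive E) in *. set (k := RtoC (r ^ 2) * c).
  apply (loewner_injective (fun x => (1 + k) * F x) (fun x => (1 + k) * E x)
    (fun x => E x * x) (fun x => E x + x * E1 x) E r).
  - intros x Hx. now apply is_derive_Cscal, analytic_is_derive.
  - intros x Hx. eapply is_derive_Ceq.
    + apply is_derive_Cmult; [now apply analytic_is_derive|apply is_derive_Cid].
    + fold E1. cbv beta. ring.
  - intros x Hx. apply continuous_Cmult; [apply continuous_const|now apply analytic_continuous].
  - intros x Hx. apply continuous_Cplus; [now apply analytic_continuous|].
    apply continuous_Cmult; [apply continuous_id|now apply analytic_continuous].
  - reflexivity.
  - exact Hr.
  - intros s x Hs Hx. unfold chain_domain in Hx. unfold chain_derive.
    assert (Hxd : in_disk x).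
    { unfold in_disk. pose proof (Cmod_ge_0 x). assert (r ^ 2 < 1) by nra. nra. }
    assert (NE := Hne x Hxd). set (Q := x * E1 x / E x).
    replace (s * ((1 + k) * E x) + (1 - s) * (E x + x * E1 x) - E x) with
      ((s * RtoC (r ^ 2) * c + (1 - s) * Q) * E x) by (unfold Q, k; field; exact NE).
    rewrite Cmod_mult. rewrite <- (Rmult_1_l (Cmod (E x))) at 2.
    apply Rmult_lt_compat_r; [now apply Cmod_gt_0|].
    destruct (Req_dec s 0) as [->|Hs0].
    + assert (Hx0 : x = 0).
      { apply Cmod_eq_0. pose proof (Cmod_ge_0 x). nra. }
      assert (HQ : Q = 0) by (unfold Q; rewrite Hx0 in *; field; exact NE).
      rewrite HQ. replace (0 * RtoC (r ^ 2) * c + (1 - 0) * 0) with (RtoC 0) by ring.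
      rewrite Cmod_0. lra.
    + apply (ahlfors_convex_bound c Q r s (Cmod x ^ 2)); auto; [lra|].
      split; [apply pow2_ge_0|exact Hx].
  - unfold r. lra.
  - unfold r. lra.
  - now rewrite Heq.
Qed.

(** * Sufficiency *)

Lemma Jgamma_segint (gamma : C) (h : C -> C) (z : C) :
  Jgamma gamma h z = segint (fun w => cexp (gamma * h w)) 0 z.
Proof.
  unfold Jgamma, segint. apply (RInt_ext (V := C_R_CompleteNormedModule)). intros t _.
  unfold seg. replace (0 + t * (z - 0)) with (t * z) by ring.
  change (cexp (gamma * h (t * z)) * z = cexp (gamma * h (t * z)) * (z - 0)). ring.
Qed.

Lemma is_derive_Jgamma (gamma : C) (h : C -> C) (z : C) : analytic_on_disk h -> in_disk z ->
  is_derive (Jgamma gamma h) z (cexp (gamma * h z)).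
Proof.
  intros Hh Hz. apply (is_derive_ext (segint (fun w => cexp (gamma * h w)) 0)).
  { intros w. symmetry. apply Jgamma_segint. }
  apply (is_derive_segint (fun w => cexp (gamma * h w))); [|exact in_disk_0|exact Hz].
  now apply analytic_cexp, analytic_scal.
Qed.

Lemma classA_Jgamma (gamma : C) (h : C -> C) :
  analytic_on_disk h -> h 0 = 0 -> classA (Jgamma gamma h).
Proof.
  intros Hh H0. split; [|split].
  - intros z Hz. eexists. now apply is_derive_Jgamma.
  - rewrite Jgamma_segint. apply segint_point.
  - eapply is_derive_Ceq; [apply is_derive_Jgamma; [exact Hh|exact in_disk_0]|].
    rewrite H0, Cmult_0_r. exact cexp_0.
Qed.

Lemma log_branch_factor (f h : C -> C) (z : C) : f 0 = 0 -> log_branch f h -> in_disk z ->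
  f z = z * cexp (h z).
Proof.
  intros Hf0 (_ & _ & Hlog) Hz. destruct (Ceq_dec z 0) as [->|Hz0]; [rewrite Hf0; ring|].
  rewrite (Hlog z Hz Hz0). field. exact Hz0.
Qed.

Lemma is_derive_log_branch (f h : C -> C) (z : C) : f 0 = 0 -> log_branch f h -> in_disk z ->
  is_derive f z (cexp (h z) * (1 + z * C_derive h z)).
Proof.
  intros Hf0 Hlog Hz. apply (is_derive_ext_disk (fun w => w * cexp (h w)) f 1).
  - intros w Hw. symmetry. now apply log_branch_factor.
  - exact Hz.
  - eapply is_derive_Ceq.
    + apply is_derive_Cmult; [apply is_derive_Cid|].
      apply is_derive_cexp_comp, analytic_is_derive; [apply Hlog|exact Hz].
    + cbv beta. ring.
Qed.

Definition spiral_coef (alpha lambda : R) : C := RtoC ((1 - lambda) * cos alpha) / cexp (0, alpha).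

Section SpiralCoef.
Variables alpha lambda : R.
Hypothesis alpha_bounds : (- (PI / 2) < alpha < PI / 2)%R.
Hypothesis lambda_lt_1 : lambda < 1.

Let k := spiral_coef alpha lambda.

Lemma spiral_coef_neq_0 : k <> 0.
Proof.
  assert (Pcos : 0 < cos alpha) by (apply cos_gt_0; lra).
  unfold k, spiral_coef. apply Cmult_neq_0.
  - apply RtoC_neq_0. nra.
  - intros H. apply (cexp_neq_0 (- (0%R, alpha))). now rewrite cexp_opp.
Qed.

Lemma Cmod_cexp_arg (t : R) : Cmod (cexp (0, t)%R) = 1%R.
Proof. rewrite Cmod_cexp. exact exp_0. Qed.

Lemma Cmod_spiral_coef_le : Cmod k <= 1 - lambda.
Proof.
  assert (Pcos : 0 < cos alpha) by (apply cos_gt_0; lra).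
  unfold k, spiral_coef. rewrite Cmod_div, Cmod_cexp_arg, Cmod_R, Rabs_right
    by (apply cexp_neq_0 || nra).
  pose proof (COS_bound alpha). nra.
Qed.

Lemma spiral_condition_half_plane (q : C) :
  lambda * cos alpha < Re (cexp (0, alpha) * q) <-> -1 < Re ((q - 1) / k).
Proof.
  assert (Pcos : 0 < cos alpha) by (apply cos_gt_0; lra).
  assert (Pk : 0 < (1 - lambda) * cos alpha) by nra.
  assert (Hq : (Re (cexp (0, alpha) * q) =
    cos alpha + (1 - lambda) * cos alpha * Re ((q - 1) / k))%R).
  { rewrite <- re_scal_l.
    replace (cexp (0, alpha) * q) with
      (cexp (0, alpha) + RtoC ((1 - lambda) * cos alpha) * ((q - 1) / k)).
    - rewrite re_plus. f_equal. simpl. rewrite exp_0. ring.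
    - unfold k, spiral_coef. field. split; [apply cexp_neq_0|]. apply RtoC_neq_0. lra. }
  rewrite Hq. set (x := Re ((q - 1) / k)). split; intros H; nra.
Qed.

End SpiralCoef.

Lemma spirallike_half_plane (alpha lambda : R) (f h : C -> C) (z : C) :
  (- (PI / 2) < alpha < PI / 2)%R -> lambda < 1 -> spirallike alpha lambda f -> log_branch f h ->
  in_disk z -> -1 < Re (z * (/ spiral_coef alpha lambda * C_derive h z)).
Proof.
  intros Ha Hl (HA & Hnz & Hre) Hlog Hz.
  assert (Hk := spiral_coef_neq_0 alpha lambda Ha Hl).
  assert (Hf0 : f 0 = 0) by apply HA.
  destruct (Ceq_dec z 0) as [->|Hz0]; [rewrite Cmult_0_l; simpl; lra|].
  specialize (Hre z _ Hz Hz0 (is_derive_log_branch f h z Hf0 Hlog Hz)).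
  rewrite (log_branch_factor f h z Hf0 Hlog Hz) in Hre.
  apply (spiral_condition_half_plane alpha lambda Ha Hl) in Hre.
  match type of Hre with _ < Re ?u =>
    replace (z * (/ spiral_coef alpha lambda * C_derive h z)) with u; [exact Hre|] end.
  field. repeat split; auto. apply cexp_neq_0.
Qed.

(* [|v| <= x |v + 2|] describes a disk of centre [2 x^2 / (1 - x^2)] and radius
   [2 x / (1 - x^2)]. *)
Lemma apollonius_disk (v : C) (x : R) : 0 <= x < 1 -> Cmod v <= x * Cmod (v + 2) ->
  Cmod (RtoC (1 - x ^ 2) * v - RtoC (2 * x ^ 2)) <= 2 * x.
Proof.
  intros Hx H. pose proof (Cmod_ge_0 v).
  assert (H2 : Cmod v ^ 2 <= x ^ 2 * Cmod (v + 2) ^ 2).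
  { rewrite <- Rpow_mult_distr. now apply pow_incr. }
  apply Rsqr_incr_0; [|apply Cmod_ge_0|lra]. rewrite !Rsqr_pow2. rewrite !Cmod2_alt in *.
  destruct v as [a b]. simpl in *.
  assert (Hq : 0 < 1 - x * x) by nra.
  assert (H3 : (1 - x * x) * (a * a + b * b) <= x * x * (4 * a + 4)) by lra.
  assert (H4 : (1 - x * x) * ((1 - x * x) * (a * a + b * b)) <= (1 - x * x) * (x * x * (4 * a + 4)))
    by (apply Rmult_le_compat_l; lra).
  lra.
Qed.

Lemma Jgamma_classS (lambda : R) (gamma : C) (f h : C -> C) : lambda < 1 ->
  Cmod gamma <= 1 / (2 * (1 - lambda)) -> classS_lambda lambda f -> log_branch f h ->
  classS (Jgamma gamma h).
Proof.
  intros Hl Hg (alpha & Ha & Hsp) Hlog. assert (Hh : analytic_on_disk h) by apply Hlog.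
  assert (HA : classA (Jgamma gamma h)) by (apply classA_Jgamma; apply Hlog).
  split; [exact HA|].
  set (k := spiral_coef alpha lambda). assert (Nk : k <> 0) by now apply spiral_coef_neq_0.
  assert (Hgk : Cmod (gamma * k) <= / 2).
  { apply Rle_trans with (1 / (2 * (1 - lambda)) * (1 - lambda))%R.
    - apply Cmod_mult_le; [exact Hg|now apply Cmod_spiral_coef_le].
    - right. field. lra. }
  assert (HJ1 : forall z, in_disk z -> C_derive (Jgamma gamma h) z = cexp (gamma * h z)).
  { intros z Hz. now apply is_C_derive_unique, is_derive_Jgamma. }
  assert (HJ2 : forall z, in_disk z -> C_derive (C_derive (Jgamma gamma h)) z =
    cexp (gamma * h z) * (gamma * C_derive h z)).
  { intros z Hz. apply is_C_derive_unique.
    apply (is_derive_ext_disk (fun w => cexp (gamma * h w)) _ 1 z); [|exact Hz|].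
    - intros w Hw. symmetry. now apply HJ1.
    - now apply (is_derive_cexp_comp (fun w => gamma * h w)), is_derive_Cscal, analytic_is_derive. }
  apply (ahlfors_univalence (Jgamma gamma h) (- (2 * (gamma * k)))).
  - apply HA.
  - rewrite Cmod_opp, Cmod_mult, Cmod_R, Rabs_right; lra.
  - intros z Hz. rewrite HJ1 by exact Hz. apply cexp_neq_0.
  - intros z Hz. rewrite HJ2, HJ1 by exact Hz. set (v := z * (/ k * C_derive h z)).
    assert (Hv : Cmod v <= Cmod z * Cmod (v + 2)).
    { unfold v at 1. rewrite Cmod_mult. apply Rmult_le_compat_l; [apply Cmod_ge_0|].
      apply (schwarz_half_plane (fun w => / k * C_derive h w)); [|..|exact Hz].
      - now apply analytic_scal, analytic_C_derive.
      - intros w Hw. now apply (spirallike_half_plane alpha lambda f). }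
    apply apollonius_disk in Hv; [|split; [apply Cmod_ge_0|exact Hz]].
    match goal with |- Cmod ?u <= 1 => replace u with
      (gamma * k * (RtoC (1 - Cmod z ^ 2) * v - RtoC (2 * Cmod z ^ 2))) end.
    + apply Rle_trans with (/ 2 * (2 * Cmod z))%R; [now apply Cmod_mult_le|].
      unfold in_disk in Hz. lra.
    + unfold v. rewrite RtoC_mult. field. split; [apply cexp_neq_0|exact Nk].
Qed.

(** * Necessity *)

(* The principal branch of [log (1 - z)]. *)
Definition log1m : C -> C := segint (fun w => - / (1 - w)) 0.

Lemma one_minus_neq_0 (z : C) : in_disk z -> 1 - z <> 0.
Proof.
  intros Hz. apply (circle_minus_neq_0 1); [exact Hz|exact Cmod_1].
Qed.

Lemma is_derive_log1m (z : C) : in_disk z -> is_derive log1m z (- / (1 - z)).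
Proof.
  apply (is_derive_segint (fun w => - / (1 - w))); [|exact in_disk_0].
  intros w Hw. eexists. apply is_derive_Copp, is_derive_Cinv_comp; [|now apply one_minus_neq_0].
  apply is_derive_Cminus; [apply is_derive_Cconst|apply is_derive_Cid].
Qed.

Lemma log1m_0 : log1m 0 = 0.
Proof. apply segint_point. Qed.

Lemma cexp_log1m (z : C) : in_disk z -> cexp (log1m z) = 1 - z.
Proof.
  intros Hz.
  assert (H : (1 - z) * cexp (- log1m z) = (1 - 0) * cexp (- log1m 0)).
  { apply (is_derive_0_disk (fun w => (1 - w) * cexp (- log1m w))); [|exact Hz].
    intros w Hw. eapply is_derive_Ceq.
    - apply is_derive_Cmult.
      + apply is_derive_Cminus; [apply is_derive_Cconst|apply is_derive_Cid].
      + apply is_derive_cexp_comp, is_derive_Copp, is_derive_log1m, Hw.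
    - cbv beta. field. now apply one_minus_neq_0. }
  rewrite log1m_0, Copp_0, cexp_0, cexp_opp in H. pose proof (cexp_neq_0 (log1m z)).
  replace (1 - z) with ((1 - z) * / cexp (log1m z) * cexp (log1m z)) by (field; auto).
  rewrite H. ring.
Qed.

(* The image of the disk under [log1m] is the region [exp (Re w) < 2 cos (Im w)] of the strip
   [|Im w| < PI / 2]. *)
Lemma in_disk_one_minus_cexp (w : C) : exp (Re w) < 2 * cos (Im w) -> in_disk (1 - cexp w).
Proof.
  intros Hw. pose proof (exp_pos (Re w)). unfold in_disk.
  apply Rsqr_incrst_0; [|apply Cmod_ge_0|lra]. rewrite !Rsqr_pow2, Cmod2_alt.
  unfold cexp. simpl. pose proof (sin2_cos2 (Im w)) as Hsc. unfold Rsqr in Hsc.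
  set (p := exp (Re w)) in *. set (x := cos (Im w)) in *. set (y := sin (Im w)) in *.
  replace ((1 + - (p * x)) * ((1 + - (p * x)) * 1) + (0 + - (p * y)) * ((0 + - (p * y)) * 1))%R
    with (1 - 2 * (p * x) + p * p * (y * y + x * x))%R by ring.
  rewrite Hsc. nra.
Qed.

Lemma log1m_one_minus_cexp_seg (a b : C) :
  (forall t : R, 0 <= t <= 1 -> exp (Re (seg a b t)) < 2 * cos (Im (seg a b t))) ->
  log1m (1 - cexp a) = a -> log1m (1 - cexp b) = b.
Proof.
  intros Hseg Ha. apply Cminus_eq_0. rewrite <- (Cplus_opp_r a). rewrite <- Ha at 1.
  apply (is_derive_0_seg (fun w => log1m (1 - cexp w) - w)). intros t Ht.
  eapply is_derive_Ceq.
  - apply is_derive_Cminus; [|apply is_derive_Cid].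
    apply (is_derive_Ccomp log1m (fun w => 1 - cexp w)).
    + apply is_derive_log1m, in_disk_one_minus_cexp, Hseg, Ht.
    + apply is_derive_Cminus; [apply is_derive_Cconst|apply is_derive_cexp].
  - cbv beta. replace (1 - (1 - cexp (seg a b t))) with (cexp (seg a b t)) by ring.
    field. apply cexp_neq_0.
Qed.

Lemma cos_Rabs (x : R) : cos (Rabs x) = cos x.
Proof. unfold Rabs. destruct (Rcase_abs x); [apply cos_neg|reflexivity]. Qed.

Lemma log1m_one_minus_cexp (w : C) : (- (PI / 2) < Im w < PI / 2)%R ->
  exp (Re w) < 2 * cos (Im w) -> log1m (1 - cexp w) = w.
Proof.
  destruct w as [u v]. simpl Re. simpl Im. intros Hv Hu. pose proof (COS_bound v) as Hcos.
  apply (log1m_one_minus_cexp_seg (u, 0%R)).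
  - intros t Ht. replace (seg (u, 0%R) (u, v) t) with ((u, t * v)%R : C)
      by (unfold seg; apply injective_projections; simpl; ring).
    simpl Re. simpl Im. eapply Rlt_le_trans; [exact Hu|]. apply Rmult_le_compat_l; [lra|].
    rewrite <- (cos_Rabs v), <- (cos_Rabs (t * v)), Rabs_mult, (Rabs_right t) by lra.
    assert (Hav : 0 <= Rabs v < PI / 2) by (split; [apply Rabs_pos|apply Rabs_def1; lra]).
    apply cos_decr_1; nra.
  - apply (log1m_one_minus_cexp_seg 0).
    + intros t Ht. replace (seg 0 (u, 0%R) t) with ((t * u, 0)%R : C)
        by (unfold seg; apply injective_projections; simpl; ring).
      simpl Re. simpl Im. rewrite cos_0, Rmult_1_r.
      assert (Hexp2 : exp (ln 2) = 2%R) by (apply exp_ln; lra). pose proof ln_lt_2.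
      assert (Hu2 : u < ln 2) by (apply exp_lt_inv; lra).
      rewrite <- Hexp2. apply exp_increasing. destruct (Rle_lt_dec 0 u); nra.
    + rewrite cexp_0. replace (RtoC 1 - 1) with (RtoC 0) by ring. exact log1m_0.
Qed.

(* [z (1 - z)^(- b)], which is extremal for [b = 2 * spiral_coef alpha lambda]. *)
Definition power_function (b z : C) : C := z * cexp (- b * log1m z).

Lemma is_derive_log_power (b z : C) : in_disk z ->
  is_derive (fun w => - b * log1m w) z (b / (1 - z)).
Proof.
  intros Hz. eapply is_derive_Ceq; [apply (is_derive_Cscal (- b) log1m), is_derive_log1m, Hz|].
  field. now apply one_minus_neq_0.
Qed.

Lemma log_branch_power (b : C) : log_branch (power_function b) (fun z => - b * log1m z).
Proof.
  split; [|split].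
  - intros z Hz. eexists. now apply is_derive_log_power.
  - rewrite log1m_0. ring.
  - intros z _ Hz0. unfold power_function. field. exact Hz0.
Qed.

Lemma is_derive_power (b z : C) : in_disk z ->
  is_derive (power_function b) z (cexp (- b * log1m z) * (1 + z * (b / (1 - z)))).
Proof.
  intros Hz. rewrite <- (is_C_derive_unique _ _ _ (is_derive_log_power b z Hz)).
  apply (is_derive_log_branch _ (fun w => - b * log1m w));
    [apply Cmult_0_l|apply log_branch_power|exact Hz].
Qed.

Lemma classA_power (b : C) : classA (power_function b).
Proof.
  split; [|split].
  - intros z Hz. eexists. now apply is_derive_power.
  - apply Cmult_0_l.
  - eapply is_derive_Ceq; [apply is_derive_power, in_disk_0|].
    rewrite log1m_0, Cmult_0_r, cexp_0. ring.
Qed.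

Lemma classS_lambda_power (alpha lambda : R) : (- (PI / 2) < alpha < PI / 2)%R -> lambda < 1 ->
  classS_lambda lambda (power_function (2 * spiral_coef alpha lambda)).
Proof.
  intros Ha Hl. assert (Nk := spiral_coef_neq_0 alpha lambda Ha Hl).
  exists alpha. split; [exact Ha|]. split; [apply classA_power|]. split.
  - intros z _ Hz0. apply Cmult_neq_0; [exact Hz0|apply cexp_neq_0].
  - intros z l Hz Hz0 Hd. assert (Nz := one_minus_neq_0 z Hz).
    rewrite <- (is_C_derive_unique _ _ _ Hd), (is_C_derive_unique _ _ _ (is_derive_power _ z Hz)).
    apply (spiral_condition_half_plane alpha lambda Ha Hl).
    unfold power_function. set (e := cexp _). assert (Ne : e <> 0) by apply cexp_neq_0.
    match goal with |- _ < Re ?u => replace u with (2 * (1 / (1 - z)) - 2) by (field; auto) end.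
    assert (Hhalf : / 2 < Re (1 / (1 - z))).
    { apply Re_div_gt_half; [exact Nz|]. replace (1 - z - 1) with (- z) by ring.
      rewrite Cmod_opp, Cmod_1. exact Hz. }
    replace (Re (2 * (1 / (1 - z)) - 2)) with (2 * Re (1 / (1 - z)) - 2)%R; [lra|].
    rewrite <- re_scal_l. reflexivity.
Qed.

Lemma Jgamma_power (gamma b : C) (z : C) (a := 1 - gamma * b) : a <> 0 -> in_disk z ->
  Jgamma gamma (fun w => - b * log1m w) z = (1 - cexp (a * log1m z)) / a.
Proof.
  intros Na Hz. set (h := fun w => - b * log1m w).
  assert (Hh : analytic_on_disk h) by apply (log_branch_power b).
  apply Cminus_eq_0.
  transitivity (Jgamma gamma h 0 - (1 - cexp (a * log1m 0)) / a).
  - apply (is_derive_0_disk (fun w => Jgamma gamma h w - (1 - cexp (a * log1m w)) / a));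
      [|exact Hz].
    intros w Hw. eapply is_derive_Ceq.
    + apply is_derive_Cminus; [now apply is_derive_Jgamma|].
      apply is_derive_Cmult; [|apply is_derive_Cconst].
      apply is_derive_Cminus; [apply is_derive_Cconst|].
      now apply is_derive_cexp_comp, is_derive_Cscal, is_derive_log1m.
    + cbv beta.
      assert (He : cexp (gamma * h w) = cexp (a * log1m w) / (1 - w)).
      { rewrite <- (cexp_log1m w Hw). unfold Cdiv. rewrite <- cexp_opp, <- cexp_plus.
        f_equal. unfold a, h. ring. }
      rewrite He. field. split; [exact Na|now apply one_minus_neq_0].
  - rewrite log1m_0, Cmult_0_r, cexp_0, Jgamma_segint, segint_point. field. exact Na.
Qed.

(* Two points whose logarithms differ by the period [2 PI i / a] have the same image; the region
   [log1m] maps onto has room for them when [|a - 1| > 1] and [|a + 1| > 1]. *)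
Lemma power_not_injective (a : C) : 1 < Cmod (a - 1) -> 1 < Cmod (a + 1) ->
  exists z w, in_disk z /\ in_disk w /\ z <> w /\ cexp (a * log1m z) = cexp (a * log1m w).
Proof.
  intros H1 H2.
  assert (S1 : 1 < Cmod (a - 1) ^ 2) by nra. assert (S2 : 1 < Cmod (a + 1) ^ 2) by nra.
  rewrite Cmod2_alt in S1, S2. destruct a as [a1 a2]. simpl in S1, S2.
  set (n := (a1 ^ 2 + a2 ^ 2)%R).
  assert (Hn1 : 2 * a1 < n) by (unfold n; lra). assert (Hn2 : - (2 * a1) < n) by (unfold n; lra).
  assert (Pn : 0 < n) by lra. pose proof PI_RGT_0.
  set (p := (2 * PI * a2 / n)%R). set (q := (2 * PI * a1 / n)%R).
  assert (Hq : (- PI < q < PI)%R).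
  { split; [apply Rlt_div_r|apply Rlt_div_l]; try exact Pn; nra. }
  assert (Hcos : 0 < cos (q / 2)) by (apply cos_gt_0; lra).
  set (u := (ln (cos (q / 2)) - Rabs p)%R).
  assert (Hu : forall x, x <= Rabs p -> exp (u + x) < 2 * cos (q / 2)).
  { intros x Hx. rewrite <- (exp_ln (2 * cos (q / 2))) by lra. apply exp_increasing.
    rewrite ln_mult by lra. pose proof ln_lt_2. unfold u. lra. }
  set (za := ((u + p, q / 2)%R : C)). set (zb := ((u, - (q / 2))%R : C)).
  assert (Hza : exp (Re za) < 2 * cos (Im za)) by apply Hu, Rle_abs.
  assert (Hzb : exp (Re zb) < 2 * cos (Im zb)).
  { simpl. rewrite cos_neg, <- (Rplus_0_r u). apply Hu, Rabs_pos. }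
  assert (La : log1m (1 - cexp za) = za) by (apply log1m_one_minus_cexp; [simpl; lra|exact Hza]).
  assert (Lb : log1m (1 - cexp zb) = zb) by (apply log1m_one_minus_cexp; [simpl; lra|exact Hzb]).
  assert (Eperiod : (a1, a2) * za = (a1, a2) * zb + (0, (2 * PI))%R).
  { apply injective_projections; simpl; unfold p, q, n in *; field; simpl; lra. }
  exists (1 - cexp za), (1 - cexp zb).
  split; [now apply in_disk_one_minus_cexp|]. split; [now apply in_disk_one_minus_cexp|].
  rewrite La, Lb, Eperiod, cexp_plus, cexp_2PI. split; [|ring].
  intros E. assert (Eab : za = zb) by now rewrite <- La, <- Lb, E.
  rewrite Eab in Eperiod. apply (f_equal (fun z => snd (z - (a1, a2) * zb))) in Eperiod.
  simpl in Eperiod. lra.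
Qed.

(* With [1 + t^2 = |G|] the point [G / (1 + i t)] has modulus [sqrt |G|]; when [t] has the sign
   opposite to [Im G], its real part is at most [1]. *)
Lemma exists_rotation_outside (G : C) : 1 < Cmod G -> exists t : R,
  1 < Cmod (G / (1 + Ci * t)) /\ 1 < Cmod (2 - G / (1 + Ci * t)).
Proof.
  intros HG. set (rho := Cmod G) in *.
  assert (Ht : exists t : R, (t ^ 2 = rho - 1)%R /\ Im G * t <= 0).
  { pose proof (sqrt_pos (rho - 1)). pose proof (pow2_sqrt (rho - 1) ltac:(lra)).
    destruct (Rle_lt_dec 0 (Im G)).
    - exists (- sqrt (rho - 1))%R. split; nra.
    - exists (sqrt (rho - 1)). split; nra. }
  destruct Ht as (t & Ht & Hs). exists t. set (c := G / (1 + Ci * t)).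
  assert (Gsqr := Cmod2_alt G). fold rho in Gsqr.
  assert (HRe : Re G <= rho) by (eapply Rle_trans; [apply Rle_abs|apply re_le_Cmod]).
  assert (Hden : (Cmod (1 + Ci * t) ^ 2)%R = rho) by (rewrite Cmod2_alt; simpl; lra).
  assert (Nden : 1 + Ci * t <> 0).
  { intros E. rewrite E, Cmod_0 in Hden. simpl in Hden. lra. }
  assert (Hc2 : (Cmod c ^ 2 = rho)%R).
  { unfold c. rewrite Cmod_div by exact Nden. fold rho. unfold Rdiv.
    rewrite Rpow_mult_distr, pow_inv, Hden. field. lra. }
  assert (Hc1 : fst c <= 1).
  { replace (fst c) with ((Re G + Im G * t) / rho)%R; [apply Rle_div_l; lra|].
    unfold c. replace rho with (1 + t ^ 2)%R by lra. destruct G. simpl. field. nra. }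
  split; apply Rnot_le_lt; intros Hle.
  - pose proof (Cmod_ge_0 c). nra.
  - pose proof (Cmod_ge_0 (2 - c)). assert (Hle2 : Cmod (2 - c) ^ 2 <= 1) by nra.
    rewrite Cmod2_alt in Hle2, Hc2. destruct c as [x y]. simpl in *. lra.
Qed.

Lemma spiral_coef_atan (lambda t : R) :
  spiral_coef (atan t) lambda = RtoC (1 - lambda) / (1 + Ci * t).
Proof.
  pose proof (atan_bound t).
  assert (Pcos : 0 < cos (atan t)) by (apply cos_gt_0; lra).
  assert (Hsin : sin (atan t) = (t * cos (atan t))%R).
  { rewrite <- (tan_atan t) at 2. unfold tan. field. lra. }
  assert (Hexp : cexp (0, atan t) = RtoC (cos (atan t)) * (1 + Ci * t)).
  { unfold cexp. simpl Re. simpl Im. rewrite exp_0, Hsin.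
    apply injective_projections; simpl; ring. }
  assert (N : 1 + Ci * t <> 0).
  { intros E. apply (cexp_neq_0 (0%R, atan t)). rewrite Hexp, E. ring. }
  unfold spiral_coef. rewrite Hexp, RtoC_mult. field. split; [exact N|].
  apply RtoC_neq_0. lra.
Qed.

Lemma J_in_S_bound (lambda : R) (gamma : C) : lambda < 1 ->
  (forall f, classS_lambda lambda f -> J_in_S gamma f) -> Cmod gamma <= 1 / (2 * (1 - lambda)).
Proof.
  intros Hl H. apply Rnot_lt_le. intros Hg. apply Rlt_div_l in Hg; [|lra].
  destruct (exists_rotation_outside (RtoC (2 * (1 - lambda)) * gamma)) as (t & Ht0 & Ht2).
  { rewrite Cmod_mult, Cmod_R, Rabs_right; lra. }
  set (b := 2 * spiral_coef (atan t) lambda).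
  pose proof (atan_bound t) as Hatan.
  destruct (H _ (classS_lambda_power (atan t) lambda ltac:(lra) Hl) _ (log_branch_power b))
    as [_ Hinj].
  assert (Eb : RtoC (2 * (1 - lambda)) * gamma / (1 + Ci * t) = gamma * b).
  { unfold b. rewrite spiral_coef_atan, RtoC_mult. unfold Cdiv. ring. }
  rewrite Eb in Ht0, Ht2. set (a := 1 - gamma * b).
  destruct (power_not_injective a) as (z & w & Hz & Hw & Hne & He).
  - replace (a - 1) with (- (gamma * b)) by (unfold a; ring). now rewrite Cmod_opp.
  - now replace (a + 1) with (2 - gamma * b) by (unfold a; ring).
  - assert (Na : a <> 0).
    { intros E. replace (gamma * b) with (1 - a) in Ht0 by (unfold a; ring).
      rewrite E in Ht0. replace (1 - 0) with (RtoC 1) in Ht0 by ring. rewrite Cmod_1 in Ht0. lra. }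
    apply Hne, Hinj; [exact Hz|exact Hw|].
    rewrite !Jgamma_power by assumption. fold a. now rewrite He.
Qed.

Close Scope C_scope.

Theorem theorem2p4 (lambda : R) (hl : lambda < 1) :
  forall gamma : C,
    (forall f : C -> C, classS_lambda lambda f -> J_in_S gamma f) <->
    Cmod gamma <= 1 / (2 * (1 - lambda)).
Proof.
  intros gamma. split.
  - now apply J_in_S_bound.
  - intros Hgamma f Hf h Hh. now apply (Jgamma_classS lambda gamma f).
Qed.
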